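(* Let $n\ge 1$, let $\lambda=(\lambda_1>\lambda_2>\cdots>\lambda_n\ge 1)$ and $\mu=(\mu_1>\cdots>\mu_{n-1}\ge 1)$ be strictly decreasing sequences of positive integers, and let $k>\lambda_1$ be an integer. Put $r(\lambda;\mu)=|\{1\le i\le n-1:\mu_i=\lambda_{i+1}\}|$, $l(\lambda;\mu)=|\{1\le i\le n-1:\mu_i=\lambda_i\}|$, $s(\lambda;\mu)=|\{1\le i\le n-1:\lambda_i>\mu_i\}|$, and $|\lambda|=\sum_i\lambda_i$, $|\mu|=\sum_i\mu_i$. Then $$\langle \mu| e^{\phi_+(x;t)}\psi_{-1/2}|\lambda\rangle=\begin{cases}(-1)^n t^{r(\lambda;\mu)}(1+t)^{s(\lambda;\mu)-r(\lambda;\mu)+1}x^{|\lambda|-|\mu|}&\text{if }\lambda_i\ge\mu_i\ge\lambda_{i+1}\text{ for all }1\le i\le n-1,\\ 0&\text{otherwise,}\end{cases}$$ and $$\langle \mu| \psi_{k-1/2}\,e^{\phi_-(x;t)}|\lambda\rangle=\begin{cases} t^{l(\lambda;\mu)}(1+t)^{s(\lambda;\mu)-r(\lambda;\mu)+1}x^{|\lambda|-|\mu|-k}&\text{if }\lambda_i\ge\mu_i\ge\lambda_{i+1}\text{ for all }1\le i\le n-1,\\ 0&\text{otherwise.}\end{cases}$$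
   Context: Let $\mathcal A$ be the associative $\mathbb C$-algebra generated by $\psi_i,\psi_i^*$, $i\in\mathbb Z+\tfrac12$, with relations $\psi_i\psi_j+\psi_j\psi_i=0$, $\psi_i^*\psi_j^*+\psi_j^*\psi_i^*=0$, $\psi_i\psi_j^*+\psi_j^*\psi_i=\delta_{ij}$. The Fock space is the left $\mathcal A$-module generated by a vacuum $|0\rangle$ with $\psi_i^*|0\rangle=0$ for $i<0$ and $\psi_i|0\rangle=0$ for $i>0$; the dual Fock space is the right module generated by $\langle 0|$ with $\langle 0|\psi_i^*=0$ for $i>0$ and $\langle0|\psi_i=0$ for $i<0$; there is the vacuum-expectation pairing $\langle 0|a\cdot b|0\rangle$ with $\langle0|0\rangle=1$, and $\langle u|X|v\rangle$ denotes the pairing of the bra $\langle u|$ with $X|v\rangle$. (Pictorially, $|0\rangle$ has particles at all negative half-integers; $\psi_i^*$ creates and $\psi_i$ destroys a particle at $i$.) For $m\neq0$ let $J_m=\sum_{i\in\mathbb Z+1/2}\psi^*_{i-m}\psi_i$. For formal variables $x,t$ define $e^{\phi_+(x;t)}=\exp\big(\sum_{q\ge1}\tfrac{1-(-t)^q}{q}x^qJ_q\big)$ and $e^{\phi_-(x;t)}=\exp\big(\sum_{q\ge1}\tfrac{1-(-t)^q}{q}x^{-q}J_{-q}\big)$. For a strictly decreasing sequence of positive integers $\lambda=(\lambda_1>\cdots>\lambda_n)$ ($n\ge0$) set $|\lambda\rangle=\psi^*_{\lambda_1-1/2}\psi^*_{\lambda_2-1/2}\cdots\psi^*_{\lambda_n-1/2}|0\rangle$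 and $\langle\lambda|=\langle0|\psi_{\lambda_n-1/2}\cdots\psi_{\lambda_1-1/2}$; for $n=0$ (the empty partition $\emptyset$) these are $|0\rangle$ and $\langle 0|$. *)

(* Defs.v *)
From HB Require Import structures.
From mathcomp Require Import all_boot all_order all_algebra.
Set Implicit Arguments. Unset Strict Implicit. Unset Printing Implicit Defensive.
Import Order.TTheory GRing.Theory Num.Theory.
Local Open Scope ring_scope.

(* A half-integer i is encoded by the integer m with i = m - 1/2.
   A basis state (Maya diagram) S is encoded by the finite (duplicate-free)
   list D of positions where S differs from the vacuum {m <= 0}
   (i.e. from {i < 0}).  The empty list is the vacuum |0>. *)
Definition state := seq int.

(* coefficient ring: polynomials in the formal variable t = 'X over rat *)
Definition coefR := {poly rat}.

(* finite linear combinations of basis states *)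
Definition vec := seq (coefR * state).

Definition occ (D : state) (m : int) : bool := (m <= 0) (+) (m \in D).

Definition flip (D : state) (m : int) : state :=
  if m \in D then filter (predC1 m) D else m :: D.

(* (-1)^(number of occupied positions strictly above m) *)
Definition sgn (D : state) (m : int) : coefR :=
  (-1) ^+ (addn (count (fun d => m < d) D) (if m < 0 then `|m|%N else 0%N)).

Definition psi_star (m : int) (D : state) : vec :=
  if occ D m then [::] else [:: (sgn D m, flip D m)].
Definition psi (m : int) (D : state) : vec :=
  if occ D m then [:: (sgn D m, flip D m)] else [::].

Definition actv (f : state -> vec) (v : vec) : vec :=
  flatten [seq [seq (cd.1 * e.1, e.2) | e <- f cd.2] | cd <- v].
Definition scalev (c : coefR) (v : vec) : vec := [seq (c * e.1, e.2) | e <- v].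

Definition vac_coef (v : vec) : coefR := \sum_(e <- v | nilp e.2) e.1.

(* J_m = sum_p psi^*_{p-m} psi_p  (m <> 0).  On a basis state D all terms
   with p outside the window [lo - |m| - 1, hi + |m| + 1] vanish, where
   lo = min(D u {0}), hi = max(D u {0}); so the infinite sum is this finite one. *)
Definition lo_st (D : state) : int := foldr (fun d a => Num.min d a) 0 D.
Definition hi_st (D : state) : int := foldr (fun d a => Num.max d a) 0 D.
Definition window (D : state) (m : int) : seq int :=
  [seq (lo_st D - (`|m|%N)%:Z - 1) + (i%:Z)
  | i <- iota 0 (`|hi_st D - lo_st D|%N + 2 * `|m|%N + 3)].
Definition Jb (m : int) (D : state) : vec :=
  flatten [seq actv (psi_star (p - m)) (psi p D) | p <- window D m].
Definition J (m : int) (v : vec) : vec := actv (Jb m) v.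

Fixpoint comps (k d : nat) : seq (seq nat) :=
  match k with
  | 0 => if d == 0%N then [:: [::]] else [::]
  | k'.+1 => flatten [seq [seq q :: c | c <- comps k' (d - q)] | q <- iota 1 d]
  end.

Definition acoef (q : nat) : coefR := (1 - (- 'X) ^+ q) * ((q%:R)^-1 : rat)%:P.

(* coefficient of x^{sg*d} in exp(sum_{q>=1} a_q x^{sg q} J_{sg q}) applied to v:
   sum_k 1/k! sum_{q1+..+qk=d} a_{q1}..a_{qk} J_{sg q1} .. J_{sg qk} v *)
Definition expPhi (sg : int) (d : nat) (v : vec) : vec :=
  flatten [seq flatten [seq scalev (((k`!%:R)^-1 : rat)%:P * \prod_(q <- c) acoef q)
                                   (foldr (fun q w => J (sg * q%:Z) w) v c)
                       | c <- comps k d]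
          | k <- iota 0 d.+1].

Definition ket (lam : seq nat) : vec :=
  foldr (fun l w => actv (psi_star l%:Z) w) [:: (1, [::])] lam.

Definition bra_pair (mu : seq nat) (w : vec) : coefR :=
  vac_coef (foldl (fun w m => actv (psi m%:Z) w) w mu).

(* coefficient of x^e in <mu| e^{phi_+(x;t)} psi_{-1/2} |lam> *)
Definition ME_plus (mu lam : seq nat) (e : int) : coefR :=
  if 0 <= e then bra_pair mu (expPhi 1 `|e|%N (actv (psi 0) (ket lam))) else 0.

(* coefficient of x^e in <mu| psi_{k-1/2} e^{phi_-(x;t)} |lam> *)
Definition ME_minus (mu lam : seq nat) (k : int) (e : int) : coefR :=
  if e <= 0 then bra_pair mu (actv (psi k) (expPhi (-1) `|e|%N (ket lam))) else 0.

Definition strict_dec_pos (s : seq nat) : Prop :=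
  sorted (fun a b : nat => (b < a)%N) s /\ all (fun a => (0 < a)%N) s.

Definition interlace (n : nat) (lam mu : seq nat) : bool :=
  all (fun i => (nth 0 lam i.+1 <= nth 0 mu i)%N && (nth 0 mu i <= nth 0 lam i)%N)
      (iota 0 n.-1).

Definition r_stat (n : nat) (lam mu : seq nat) : nat :=
  count (fun i => nth 0 mu i == nth 0 lam i.+1) (iota 0 n.-1).
Definition l_stat (n : nat) (lam mu : seq nat) : nat :=
  count (fun i => nth 0 mu i == nth 0 lam i) (iota 0 n.-1).
Definition s_stat (n : nat) (lam mu : seq nat) : nat :=
  count (fun i => nth 0 mu i < nth 0 lam i)%N (iota 0 n.-1).

(* Main.v *)
Require Import Defs.
From HB Require Import structures.
From mathcomp Require Import all_boot all_order all_algebra.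
From mathcomp Require Import ring zify finmap boolp functions.
Set Implicit Arguments. Unset Strict Implicit. Unset Printing Implicit Defensive.
Import Order.TTheory GRing.Theory Num.Theory.
Local Open Scope ring_scope.

(** Conjugation by e^{phi_+} multiplies the generating series of the psi^*_j by
    (1 + t z) / (1 - z).  Clearing the denominator gives the local relation
      E_d psi^*_j = psi^*_j E_d + E_{d-1} psi^*_{j-1} + t psi^*_{j-1} E_{d-1}
    for the coefficients E_d of e^{phi_+}.  Applied to the first part of lambda, it moves that
    part down by one, up to terms in which the part is contracted with the bra; the part dies
    when it meets the next one, since psi^*_j psi^*_j = 0.  The resulting recursion is solved by
    a product of local weights.  For e^{phi_-} the relation is the mirror one for the psi_j, and
    the recursion runs on the bra (k, mu) instead of the ket.  In the first matrix element,
    psi_{-1/2} is moved to the left of lambda: it lowers the Dirac sea by one level and adds a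
    part 0 to mu. *)

(** * Conjugation by the exponential of a current *)

(** Left in place, the denominator 1 - z would move a part down by every amount at once; the cleared
    relation has three terms, so an induction on the gap between consecutive parts suffices. The
    relation itself comes from power series: the c_q are the coefficients of a logarithm, the
    commutator with sum_q c_q z^q J_q multiplies the symbol of a combination of the Y_j by this
    logarithm, and exponentiation gives back the ratio. All series are truncated to polynomials, and
    bounds on the order of vanishing replace convergence. The obstacle on the Fock space side is
    that J_m is an infinite sum and that lists of weighted states are not a module. Functionals
    remove both: evaluated at one state, the transposed current is a finite sum, and the linear
    operators on functionals form an algebra. The price is that every product is reversed. *)

Definition invfact (k : nat) : coefR := (((k`!)%:R)^-1 : rat)%:P.

Lemma natr_coefR_neq0 n : (n.+1%:R : coefR) != 0.
Proof. by rewrite -polyC_natr polyC_eq0 pnatr_eq0. Qed.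

Lemma invfact0 : invfact 0 = 1.
Proof. by rewrite /invfact fact0 invr1. Qed.

Lemma invfactS k : k.+1%:R * invfact k.+1 = invfact k.
Proof.
rewrite /invfact factS natrM invfM polyCM -polyC_natr mulrA -polyCM.
by rewrite divff ?mul1r // pnatr_eq0.
Qed.

Lemma invfactS' k : invfact k.+1 * k.+1%:R = invfact k.
Proof. by rewrite mulrC invfactS. Qed.

Lemma invfact_bin k i : (i <= k)%N ->
  invfact k * ('C(k, i))%:R = invfact i * invfact (k - i).
Proof.
move=> le_ik; rewrite /invfact -polyC_natr -!polyCM; congr (_%:P).
have Hf m : ((m`!)%:R : rat) != 0 by rewrite pnatr_eq0 -lt0n fact_gt0.
apply: (mulIf (Hf i)); apply: (mulIf (Hf (k - i)%N)).
apply: (mulIf (Hf k)); rewrite -(bin_fact le_ik) !natrM.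
have := Hf k; rewrite -(bin_fact le_ik) !natrM !mulf_eq0 !negb_or.
case/andP=> Hb /andP[Hi Hk]; field; rewrite Hb Hi Hk //.
Qed.

(** Divisibility by X^n, stated on coefficients so that it also serves polynomials over the
    noncommutative algebra of operators. *)
Definition vanish_below (R : nzRingType) (n : nat) (p : {poly R}) :=
  forall d, (d < n)%N -> p`_d = 0.

Lemma vanish_belowM (R : nzRingType) m n (p q : {poly R}) :
  vanish_below m p -> vanish_below n q -> vanish_below (m + n) (p * q).
Proof.
move=> Hp Hq d lt_d; rewrite coefM big1 // => i _.
have [lt_im | le_mi] := ltnP i m; first by rewrite Hp ?mul0r.
by rewrite Hq ?mulr0 //; have := ltn_ord i; lia.
Qed.

Lemma vanish_below_exp (R : nzRingType) k (p : {poly R}) :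
  p`_0 = 0 -> vanish_below k (p ^+ k).
Proof.
move=> p0; have H1 : vanish_below 1 p by case.
elim: k => [|k IH] //; rewrite exprS -add1n; exact: vanish_belowM.
Qed.

Section ExpRatio.
Variables (a b : coefR) (c : nat -> coefR) (N : nat).
Hypothesis c_log : forall q, q%:R * c q = (- b) ^+ q - (- a) ^+ q.
Hypothesis c0 : c 0 = 0.

(** Since log (1 + a z) = - sum_q (- a)^q z^q / q, the hypothesis [c_log] makes this the truncation
    of log ((1 + a z) / (1 + b z)). *)
Definition logpoly : {poly coefR} := \poly_(q < N.+1) c q.
Definition exppoly : {poly coefR} :=
  \sum_(k < N.+1) invfact k *: logpoly ^+ k.

Lemma logpoly0 : logpoly`_0 = 0.
Proof. by rewrite coef_poly c0. Qed.


(** E' = L' E holds up to the last term of the truncation, which has order at least N because L has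
    no constant term. *)
Lemma deriv_exppoly :
  exppoly^`() = logpoly^`() * (exppoly - invfact N *: logpoly ^+ N).
Proof.
rewrite /exppoly raddf_sum /= big_ord_recl /= expr0 linearZ /= derivC scaler0 add0r.
rewrite [in RHS]big_ord_recr /= addrK mulr_sumr.
apply: eq_bigr => i _; rewrite linearZ /= deriv_exp /= /bump leq0n add1n /=.
by rewrite -[_ *+ i.+1]mulr_natl -polyC_natr mul_polyC scalerA invfactS' -scalerAr.
Qed.

(** The logarithmic derivative a / (1 + a z) - b / (1 + b z) equals (a - b) / ((1 + a z) (1 + b z));
    truncation of L leaves its coefficients below N intact. *)
Lemma logpoly_log_deriv d : (d < N)%N ->
  ((1 + a *: 'X) * ((1 + b *: 'X) * logpoly^`()))`_d = (a - b) * (d == 0)%:R.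
Proof.
move=> lt_dN.
have H i : (i <= d)%N -> logpoly^`()`_i = (- b) ^+ i.+1 - (- a) ^+ i.+1.
  move=> le_id; rewrite coef_deriv coef_poly ltnS (leq_ltn_trans le_id lt_dN).
  by rewrite -mulr_natl c_log.
rewrite !mulrDl !mul1r -!scalerAl !coefD !coefZ !coefXM coefD coefZ coefXM.
case: d lt_dN H => [|[|d]] _ H /=; rewrite ?eqxx ?mulr0 ?mulr1 ?addr0.
- by rewrite H // !expr1; ring.
- rewrite !H //; ring.
- by rewrite (H d.+2) // (H d.+1) ?leqnSn // (H d) ?leqW // !exprS; ring.
Qed.

(** Up to order N, u = (1 + b X) E solves (1 + a X) u' = a u with u(0) = 1. In characteristic zero
    this determines u, and 1 + a X is a solution. *)
Lemma exppoly_ratio d : (d <= N)%N ->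
  ((1 + b *: 'X) * exppoly)`_d = (1 + a *: 'X)`_d.
Proof.
set u := (1 + b *: 'X) * exppoly => le_dN.
have Du : (1 + a *: 'X) * u^`() - a *: u =
    exppoly * ((b - a)%:P + (1 + a *: 'X) * ((1 + b *: 'X) * logpoly^`()))
    - (1 + a *: 'X) * (1 + b *: 'X) * logpoly^`() * (invfact N *: logpoly ^+ N).
  rewrite /u derivM deriv_exppoly derivD derivC linearZ /= derivX -!mul_polyC polyCB.
  ring.
have Hlow i : (i < N)%N -> ((1 + a *: 'X) * u^`() - a *: u)`_i = 0.
  move=> lt_iN; rewrite Du coefB.
  rewrite [X in X - _](_ : _ = 0); last first.
    rewrite mulrC; apply: (@vanish_belowM _ N 0) => // [j lt_jN|]; last by rewrite addn0.
    rewrite coefD logpoly_log_deriv // coefC; case: j {lt_jN} => [|j] /=; ring.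
  rewrite sub0r [X in - X](_ : _ = 0) ?oppr0 //.
  rewrite -scalerAr coefZ [X in _ * X](_ : _ = 0) ?mulr0 //.
  by apply: (@vanish_belowM _ 0 N) => //; apply/vanish_below_exp/logpoly0.
(* At i = 1 the factor 1 - i vanishes, which kills every coefficient from the second on. *)
have rec i : (i < N)%N -> i.+1%:R * u`_i.+1 = a * (1 - i%:R) * u`_i.
  move=> lt_iN; have := Hlow i lt_iN.
  rewrite coefB mulrDl mul1r -scalerAl coefD !coefZ coefXM coef_deriv.
  case: i lt_iN => [|i] lt_iN /=.
    by rewrite mulr0 addr0 => /eqP; rewrite subr_eq0 => /eqP E; rewrite mulr_natl E; ring.
  rewrite coef_deriv => /eqP; rewrite subr_eq0 => /eqP E.
  by rewrite mulr_natl -[LHS](addrK (a * (u`_i.+1 *+ i.+1))) E -mulr_natl; ring.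
have u0 : u`_0 = 1.
  rewrite /u mulrDl mul1r -scalerAl coefD coefZ coefXM mulr0 addr0.
  rewrite /exppoly coef_sum big_ord_recl /= invfact0 scale1r expr0 coefC eqxx big1 ?addr0 //.
  by move=> i _; rewrite coefZ (vanish_below_exp logpoly0) ?mulr0.
have inj i x y : (i.+1%:R : coefR) * x = i.+1%:R * y -> x = y.
  exact/mulfI/natr_coefR_neq0.
case: d le_dN => [_|]; first by rewrite u0 coefD coefZ coefC coefX mulr0 addr0.
elim=> [|d IH] le_dN.
  by have := rec _ le_dN; rewrite u0 coefD coefZ coefC coefX /= mul1r add0r => ->; ring.
apply: (inj d.+1); rewrite rec // IH 1?ltnW //.
rewrite !coefD !coefZ !coefC !coefX /=; case: d {IH le_dN} => [|d] /=; ring.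
Qed.
End ExpRatio.

Section ExpConjugation.
Variables (A : algType coefR) (c : nat -> coefR) (J : nat -> A).

(* Coefficient of z^d in the k-th power of sum_q c_q z^q J_q; [exp_op d] truncates the
   exponential series at k = d, which is exact only because c_0 = 0 is assumed below. *)
Fixpoint exp_pow (k d : nat) : A :=
  if k is k'.+1 then \sum_(q < d.+1) exp_pow k' (d - q) * (c q *: J q)
  else (d == 0)%:R.

Definition exp_op (d : nat) : A := \sum_(k < d.+1) invfact k *: exp_pow k d.

Variables (a b : coefR) (Y : int -> A).
Hypothesis c_log : forall q, q%:R * c q = (- b) ^+ q - (- a) ^+ q.
Hypothesis c0 : c 0 = 0.
Hypothesis J_Y : forall q j, (0 < q)%N -> J q * Y j = Y j * J q + Y (j - q%:Z).

Variable N : nat.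
Let jpoly : {poly A} := \poly_(q < N.+1) (c q *: J q).

Lemma coef_jpoly d : (d <= N)%N -> jpoly`_d = c d *: J d.
Proof. by move=> le_dN; rewrite coef_poly ltnS le_dN. Qed.

Lemma jpoly_vanish : vanish_below 1 jpoly.
Proof. by case=> // _; rewrite coef_jpoly // c0 scale0r. Qed.

Lemma coef_jpoly_exp k d : (d <= N)%N -> (jpoly ^+ k)`_d = exp_pow k d.
Proof.
elim: k d => [|k IH] d le_dN /=; first by rewrite expr0 coefC; case: eqP.
rewrite exprSr coefMr; apply: eq_bigr => q _.
have := ltn_ord q; rewrite ltnS => le_q.
by rewrite IH ?coef_jpoly //; lia.
Qed.

Let epoly : {poly A} :=
  \sum_(k < N.+1) (invfact k)%:A *: jpoly ^+ k.

(** A power k > d of [jpoly] has order above d, so any truncation N >= d yields the same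
    coefficient. *)
Lemma coef_epoly d : (d <= N)%N -> epoly`_d = exp_op d.
Proof.
move=> le_dN; rewrite coef_sum /exp_op -(big_mkord xpredT (fun k => invfact k *: exp_pow k d)).
rewrite -(big_mkord xpredT (fun k => ((invfact k)%:A *: jpoly ^+ k)`_d)).
rewrite (@big_cat_nat _ _ _ d.+1) //= [X in _ + X]big1_seq ?addr0.
  by apply: eq_bigr => k _; rewrite coefZ coef_jpoly_exp // mulr_algl.
move=> k /andP[_]; rewrite mem_index_iota => /andP[lt_dk _].
by rewrite coefZ (vanish_below_exp (jpoly_vanish _)) // mulr0.
Qed.

(** Scalars of [coefR] act on [{poly A}] through multiples of 1, which are central. *)
Lemma alg_scaleM x y (p q : {poly A}) :
  (x%:A *: p) * (y%:A *: q) = (x * y)%:A *: (p * q).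
Proof.
apply/polyP=> d; rewrite coefZ !coefM mulr_algl scaler_sumr; apply: eq_bigr => i _.
by rewrite !coefZ !mulr_algl -scalerAl -scalerAr scalerA.
Qed.

(* The generating polynomial of sum_m p_m z^m Y_(j-m). *)
Definition shift_act (p : {poly coefR}) (j : int) : {poly A} :=
  \poly_(m < size p) (p`_m *: Y (j - m%:Z)).

Lemma coef_shift_act p j d : (shift_act p j)`_d = p`_d *: Y (j - d%:Z).
Proof.
rewrite coef_poly; case: ltnP => // le_d.
by rewrite [p`__]nth_default ?scale0r.
Qed.

Lemma shift_actZ x p j : shift_act (x *: p) j = x%:A *: shift_act p j.
Proof.
by apply/polyP=> d; rewrite coefZ !coef_shift_act coefZ mulr_algl scalerA.
Qed.

Lemma shift_act_sum n (F : 'I_n -> {poly coefR}) j :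
  shift_act (\sum_i F i) j = \sum_i shift_act (F i) j.
Proof.
apply/polyP=> d; rewrite coef_shift_act !coef_sum scaler_suml.
by apply: eq_bigr => i _; rewrite coef_shift_act.
Qed.

(** The commutator with [jpoly] is multiplication of the symbol [p] by [logpoly], so iterated
    commutators stay in the family [shift_act]. *)
Lemma jpoly_shift_act p j :
  jpoly * shift_act p j = shift_act p j * jpoly + shift_act (logpoly c N * p) j.
Proof.
apply/polyP=> d; rewrite coefD coefM coefMr coef_shift_act coefM scaler_suml.
rewrite -big_split /=; apply: eq_bigr => q _.
have := ltn_ord q; rewrite ltnS => le_qd.
rewrite coef_shift_act /jpoly /logpoly !coef_poly; case: ltnP => _; last first.
  by rewrite mul0r mulr0 mul0r scale0r addr0.
case: (posnP q) => [->|q_gt0].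
  by rewrite c0 !scale0r mulr0 !mul0r scale0r addr0.
rewrite -scalerAl -!scalerAr -scalerAl J_Y // !scalerDr !scalerA.
congr (_ + _ *: Y _).
by lia.
Qed.

(** Left multiplication by [jpoly] is the sum of its commutator and of right multiplication. These
    two commute, whence a binomial formula. *)
Lemma jpoly_exp_act k j :
  jpoly ^+ k * (Y j)%:P =
  \sum_(i < k.+1) ('C(k, i))%:R * (shift_act (logpoly c N ^+ i) j * jpoly ^+ (k - i)).
Proof.
elim: k => [|k IH].
  rewrite big_ord1 /= bin0 !mul1r mulr1; apply/polyP=> d.
  by rewrite coef_shift_act expr0 !coefC; case: eqP => [->|]; rewrite ?scale1r ?scale0r ?subr0.
have stepE (i : 'I_k.+1) : jpoly * (('C(k, i))%:R * (shift_act (logpoly c N ^+ i) j * jpoly ^+ (k - i)))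
  = ('C(k, i))%:R * (shift_act (logpoly c N ^+ i) j * jpoly ^+ (k.+1 - i))
  + ('C(k, i))%:R * (shift_act (logpoly c N ^+ i.+1) j * jpoly ^+ (k - i)).
  have le_ik := ltn_ord i; rewrite ltnS in le_ik.
  rewrite mulrA commr_nat -mulrA -mulrDr; congr (_ * _).
  by rewrite subSn // exprS [jpoly * (_ * _)]mulrA jpoly_shift_act mulrDl exprS !mulrA.
rewrite exprS -mulrA IH mulr_sumr (eq_bigr _ (fun i _ => stepE i)) big_split /=.
rewrite [in RHS]big_ord_recl /= bin0.
under [in RHS]eq_bigr => i _ do rewrite /bump leq0n add1n subSS binS natrD mulrDl.
rewrite big_split /= addrA; congr (_ + _).
rewrite [in LHS]big_ord_recl bin0; congr (_ + _).
rewrite [in RHS]big_ord_recr /= bin_small // mul0r addr0.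
by apply: eq_bigr => i _; rewrite /bump leq0n add1n subSS.
Qed.

(** In divided powers the binomial formula becomes a convolution, and the double sum factors as the
    exponential of the symbol times the exponential of the operator. *)
Lemma epoly_act j d : (d <= N)%N ->
  (epoly * (Y j)%:P)`_d = (shift_act (exppoly c N) j * epoly)`_d.
Proof.
move=> le_dN.
pose D k : {poly A} := (invfact k)%:A *: jpoly ^+ k.
pose T i := shift_act (invfact i *: logpoly c N ^+ i) j.
have vD k : vanish_below k (D k).
  by move=> m lt_mk; rewrite coefZ (vanish_below_exp (jpoly_vanish _)) ?mulr0.
have vT i : vanish_below i (T i).
  move=> m lt_mk; rewrite coef_shift_act coefZ (vanish_below_exp (logpoly0 _ c0)) //.
  by rewrite mulr0 scale0r.
have -> : epoly * (Y j)%:P = \sum_(k < N.+1) \sum_(i < N.+1 | (i <= k)%N) T i * D (k - i)%N.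
  rewrite /epoly mulr_suml; apply: eq_bigr => k _.
  rewrite -scalerAl jpoly_exp_act scaler_sumr.
  have le_kN : (k.+1 <= N.+1)%N := ltn_ord k.
  rewrite (big_ord_widen _ (fun i => (invfact k)%:A *: (('C(k, i))%:R * (shift_act (logpoly c N ^+ i) j * jpoly ^+ (k - i)))) le_kN).
  apply: eq_bigr => i le_ik; rewrite ltnS in le_ik.
  rewrite /T /D shift_actZ; apply/polyP=> m.
  rewrite alg_scaleM !coefZ mulr_natl coefMn !mulr_algl -scalerMnr scalerMnl -mulr_natr.
  by rewrite invfact_bin.
have -> : shift_act (exppoly c N) j * epoly = \sum_(i < N.+1) \sum_(l < N.+1) T i * D l.
  rewrite shift_act_sum mulr_suml; apply: eq_bigr => i _.
  by rewrite /epoly mulr_sumr.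
rewrite (exchange_big_dep xpredT) //= !coef_sum; apply: eq_bigr => i _; rewrite !coef_sum.
have le_iN : (i <= N)%N by rewrite -ltnS.
pose F k := (T i * D (k - i)%N)`_d.
rewrite -(big_mkord (fun k => (i <= k)%N) F) -(big_mkord xpredT (fun l => (T i * D l)`_d)).
rewrite (@big_cat_nat _ _ _ i) //=; last exact: leqW.
rewrite big_nat_cond big_pred0 ?add0r; last by move=> k; rewrite /=; lia.
(* The product has additional terms with i + l > N; their order exceeds d. *)
rewrite [RHS](@big_cat_nat _ _ _ (N.+1 - i)) //= ?leq_subr //.
rewrite [X in _ = _ + X]big_nat_cond [X in _ = _ + X]big1 ?addr0; last first.
  move=> l; rewrite andbT => /andP[le_l _].
  by apply: (vanish_belowM (vT i) (vD l)); lia.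
rewrite -{1}[i : nat]add0n big_addn big_nat_cond [RHS]big_nat_cond.
apply: eq_big => [l|l _]; first by lia.
by rewrite /F addnK.
Qed.

Lemma exp_op_conj_below d j : (d < N)%N ->
  exp_op d.+1 * Y j + b *: (exp_op d * Y (j - 1)) =
  Y j * exp_op d.+1 + a *: (Y (j - 1) * exp_op d).
Proof.
move=> lt_dN; have le_dN := ltnW lt_dN.
rewrite -(coef_epoly lt_dN) -(coef_epoly le_dN).
have L i k : (i <= N)%N -> epoly`_i * Y k = (shift_act (exppoly c N) k * epoly)`_i.
  by move=> le_i; rewrite -epoly_act // coefMC.
rewrite !L //.
(* Passing from j to j - 1 multiplies the symbol by X, so the two terms combine into the symbol (1 +
   b X) E, which agrees with 1 + a X up to degree N. *)
have -> : (shift_act (exppoly c N) j * epoly)`_d.+1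
   + b *: (shift_act (exppoly c N) (j - 1) * epoly)`_d
   = (shift_act ((1 + b *: 'X) * exppoly c N) j * epoly)`_d.+1.
  have -> : shift_act ((1 + b *: 'X) * exppoly c N) j =
            shift_act (exppoly c N) j + b%:A *: ('X * shift_act (exppoly c N) (j - 1)).
    apply/polyP=> m; rewrite coefD coefZ coefXM !coef_shift_act mulrDl mul1r coefD.
    rewrite -scalerAl coefZ coefXM scalerDl; congr (_ + _).
    case: m => [|m] /=; first by rewrite !mulr0 scale0r.
    by rewrite mulr_algl scalerA; congr (_ *: Y _); lia.
  by rewrite mulrDl coefD -scalerAl coefZ -mulrA coefXM mulr_algl.
have -> : (shift_act ((1 + b *: 'X) * exppoly c N) j * epoly)`_d.+1
        = (shift_act (1 + a *: 'X) j * epoly)`_d.+1.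
  rewrite !coefM; apply: eq_bigr => i _; rewrite !coef_shift_act (exppoly_ratio c_log c0) //.
  by have := ltn_ord i; lia.
have -> : shift_act (1 + a *: 'X) j = (Y j)%:P + (a *: Y (j - 1)) *: 'X.
  apply/polyP=> m; rewrite coef_shift_act !coefD !coefZ !coefC !coefX.
  case: m => [|[|m]] /=.
  - by rewrite !mulr0 !addr0 scale1r; congr (Y _); lia.
  - by rewrite !mulr1 !add0r.
  - by rewrite !mulr0 !addr0 scale0r.
by rewrite mulrDl coefD coefCM -scalerAl coefZ coefXM -scalerAl.
Qed.
End ExpConjugation.

(* exp(sum_q c_q z^q) = (1 + a z) / (1 + b z), and conjugation by exp(sum_q c_q z^q J_q)
   multiplies the generating series of the Y_j by this ratio. *)
Lemma exp_op_conj (A : algType coefR) (c : nat -> coefR) (J : nat -> A)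
    (a b : coefR) (Y : int -> A) :
  (forall q, q%:R * c q = (- b) ^+ q - (- a) ^+ q) -> c 0 = 0 ->
  (forall q j, (0 < q)%N -> J q * Y j = Y j * J q + Y (j - q%:Z)) ->
  forall d j, exp_op c J d.+1 * Y j + b *: (exp_op c J d * Y (j - 1)) =
              Y j * exp_op c J d.+1 + a *: (Y (j - 1) * exp_op c J d).
Proof. by move=> Hc c0 HJ d j; apply: (@exp_op_conj_below _ _ _ _ _ _ Hc c0 HJ d.+1). Qed.

(** * The recursion and its product solution *)

(* Row weight of a part l of lambda, with next part h, against the part v of nu. *)
Definition step_weight (l h v : int) : coefR :=
  if v == l then 1 else if (h < v) && (v < l) then 1 + 'X else
  if v == h then 'X else 0.

(* [b] is the top level of the Dirac sea and acts as the part that follows the last one. *)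
Fixpoint weight (b : int) (lam nu : seq int) : coefR :=
  match lam, nu with
  | [::], [::] => 1
  | l :: lam', v :: nu' => step_weight l (head b lam') v * weight b lam' nu'
  | _, _ => 0
  end.

Definition isum (s : seq int) : int := \sum_(x <- s) x.

Lemma isum_cons x s : isum (x :: s) = x + isum s.
Proof. exact: big_cons. Qed.

(** With the sentinel [b] at the end, the lower bound becomes one more strict descent, and [b]
    serves as the next part of the last one, as in [weight]. *)
Definition decr_above (b : int) (s : seq int) := sorted (fun x y : int => y < x) (rcons s b).

Lemma decr_aboveE b x s :
  decr_above b (x :: s) = (head b s < x) && decr_above b s.
Proof. by rewrite /decr_above; case: s => //=; rewrite andbT. Qed.

Lemma decr_above_gt b s : decr_above b s -> {in s, forall x, b < x}.
Proof.
rewrite /decr_above (sorted_pairwise (rev_trans lt_trans)) -cats1 pairwise_cat.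
case/and3P=> /allrelP H _ _ x xs; apply: (H x b xs); exact: mem_head.
Qed.

Lemma decr_above_lt b x s : decr_above b (x :: s) -> {in s, forall y, y < x}.
Proof.
rewrite /decr_above (sorted_pairwise (rev_trans lt_trans)) rcons_cons /= all_rcons.
by case/andP=> /andP[_ /allP H] _ y ys; exact: H.
Qed.

Lemma decr_above_rem b x s : decr_above b s -> decr_above b (rem x s).
Proof.
apply: subseq_sorted; first exact: (rev_trans lt_trans).
by rewrite -!cats1 cat_subseq // rem_subseq.
Qed.

Lemma head_ge b s : decr_above b s -> b <= head b s.
Proof. by case: s => //= x s /decr_above_gt H; rewrite ltW // H ?mem_head. Qed.

(** A row weight vanishes for v > l, so a nonzero weight cannot increase the sum. In the recursion
    this excludes negative degrees. *)
Lemma weight_sum_lt b lam nu : decr_above b lam -> isum lam < isum nu -> weight b lam nu = 0.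
Proof.
elim: lam nu => [|l lam IH] [|v nu] //=; first by rewrite ltxx.
rewrite decr_aboveE !isum_cons => /andP[lt_hl dec] Hlt.
case: (ltP l v) => [lt_lv|le_vl].
  by rewrite /step_weight !ifF ?mul0r //; lia.
by rewrite IH ?mulr0 //; lia.
Qed.

Section Recursion.
Variables (b : int) (G : seq int -> nat -> seq int -> coefR).

(** Wick contraction of the fermion at j with the equal factor of [nu]; the sign counts the factors
    passed. [G] stands for both amplitudes: [amp_plus] with b = -1 and [amp_minus] with b = 0. *)
Definition contraction (j : int) lam d nu : coefR :=
  if j \in nu then (-1) ^+ index j nu * G lam d (rem j nu) else 0.

Hypothesis G_nil : forall d, G [::] d [::] = (d == 0)%:R.
Hypothesis G_dup : forall j lam d nu, G [:: j, j & lam] d nu = 0.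
Hypothesis G_base : forall d (v : int), b < v -> G [:: b + 1] d [:: v] = ((d == 0) && (v == b + 1))%:R.
Hypothesis G_rec : forall (j : int) lam d nu,
  b + 1 < j -> decr_above b nu -> size nu = (size lam).+1 ->
  G (j :: lam) d nu = contraction j lam d nu +
    (if d is d'.+1 then G (j - 1 :: lam) d' nu + 'X * contraction (j - 1) lam d' nu else 0).

(** Outer induction on [lam], inner induction on the gap between the first part and the next one. *)
Lemma G_weight lam d nu : decr_above b lam -> decr_above b nu -> size nu = size lam ->
  G lam d nu = weight b lam nu * (d%:Z == isum lam - isum nu)%:R.
Proof.
elim: lam d nu => [|l lam IH] d [|v nu] //.
  by move=> _ _ _; rewrite G_nil mul1r /isum !big_nil.
rewrite decr_aboveE => /andP[lt_hl dec_lam] dec_nu [size_nu].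
have dec_nu' : decr_above b nu by move: dec_nu; rewrite decr_aboveE => /andP[].
(* Only the first entry v of [nu] can be contracted: removing a later entry x leaves v > x in front,
   above the head of [lam], and the remaining weight is 0. *)
have contr (x : int) d' : head b lam <= x -> contraction x lam d' (v :: nu) =
    (x == v)%:R * (weight b lam nu * (d'%:Z == isum lam - isum nu)%:R).
  move=> le_hx; rewrite /contraction inE /=; case: (eqVneq x v) => [->|neq_xv] /=.
    by rewrite !mul1r IH.
  rewrite mul0r; case: ifP => // x_nu.
  have lt_xv := decr_above_lt dec_nu x_nu.
  rewrite IH //=; last 2 first.
  - by have := decr_above_rem x dec_nu; rewrite /= eq_sym (negbTE neq_xv).
  - by rewrite size_rem // -size_nu; case: (nu) x_nu.
  case: lam le_hx dec_lam {IH lt_hl size_nu} => [|h lam] /= le_hx.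
    by rewrite mul0r mulr0.
  rewrite decr_aboveE => /andP[lt_h _].
  by rewrite /step_weight !ifF ?mul0r ?mulr0 //; lia.
have le_bh := head_ge dec_lam.
have lt_bv : b < v by apply: (decr_above_gt dec_nu); rewrite mem_head.
have -> : weight b (l :: lam) (v :: nu) = step_weight l (head b lam) v * weight b lam nu by [].
have -> : isum (l :: lam) - isum (v :: nu) = l - v + (isum lam - isum nu).
  by rewrite !isum_cons; ring.
have W0 : isum lam < isum nu -> weight b lam nu = 0 by exact: weight_sum_lt.
set W := weight b lam nu in contr W0 *; set D : int := isum lam - isum nu in contr *.
have {}W0 : D < 0 -> W = 0 by rewrite /D => ?; apply: W0; lia.
have [k Dk] : exists k : nat, l = head b lam + 1 + k%:Z :> int.
  by exists (absz (l - head b lam - 1)%R); lia.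
(* In degree 0 only v = l' survives: a smaller v would require D < 0, where W = 0. *)
have grade0 (l' : int) : head b lam < l' -> (l' == v)%:R * (W * (0%:Z == D)%:R) =
    step_weight l' (head b lam) v * W * (0%:Z == l' - v + D)%:R.
  move=> lt_hl'; case: (ltP D 0) => [/W0 ->|D_ge0]; first by rewrite !(mulr0, mul0r).
  rewrite /step_weight; case: (eqVneq l' v) => [<-|neq_lv].
    by rewrite subrr add0r mulrA.
  rewrite mul0r; case: ltP => lt1; case: ltP => lt2 /=; try (by rewrite ifF ?mul0r //; lia);
    by rewrite [_ == _ + _](_ : _ = false) ?mulr0 //; lia.
have gradeS (l' : int) (d' : nat) : head b lam < l' ->
    (l' == v)%:R * (W * (d'.+1%:Z == D)%:R) = (l' == v)%:R * W * (d'.+1%:Z == l' - v + D)%:R.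
  by move=> _; case: eqP => [<-|_]; rewrite ?mul0r // subrr add0r !mul1r.
have gradeS1 (l' : int) (d' : nat) :
    (l' - 1 == v)%:R * (W * (d'%:Z == D)%:R) = (l' - 1 == v)%:R * W * (d'.+1%:Z == l' - v + D)%:R.
  case: eqP => [<-|_]; rewrite ?mul0r // !mul1r; congr (_ * (nat_of_bool _)%:R).
  by apply/idP/idP; lia.
elim: k l d lt_hl Dk => [|k IHk] l d lt_hl Dk.
  case: (ltP (b + 1) l) => [lt_bl|le_lb].
    (* Without a gap, the lowered part collides with the next one. *)
    have Gd' d' : G (l - 1 :: lam) d' (v :: nu) = 0.
      case: (lam) Dk lt_bl => [|h lam'] /= -> lt_bl; first by lia.
      by rewrite addr0 addrK G_dup.
    rewrite G_rec //= ?size_nu // contr; last by lia.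
    case: d => [|d]; first by rewrite addr0 grade0.
    rewrite Gd' contr; last by lia.
    (* Here l - 1 is the next part, so the second contraction is the source of the weight ['X] at v
       = h. *)
    rewrite gradeS // gradeS1 add0r mulrA -mulrDl !mulrA -mulrDl; congr (_ * _ * _).
    rewrite /step_weight; case: (eqVneq l v) => [<-|neq_lv].
      by rewrite [_ == _](_ : _ = false) ?mulr0 ?addr0 //; lia.
    rewrite ifF; last by lia.
    rewrite add0r; case: eqP => E; first by rewrite ifT ?mulr1 //; lia.
    by rewrite ifF ?mulr0 //; lia.
  (* The part l = b + 1 lies just above the sea and leaves no room for further parts. *)
  have lam0 : lam = [::].
    case: (lam) lt_hl dec_lam => //= h lam' lt_hl /decr_above_gt H.
    by have := H h (mem_head _ _); lia.
  move: size_nu; rewrite lam0 /= => /size0nil nu0; rewrite /W /D lam0 nu0.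
  have -> : l = b + 1 by move: Dk; rewrite lam0 /= addr0.
  rewrite G_base // /step_weight /isum big_nil addr0 mulr1; case: (eqVneq v (b + 1)) => [->|neq_v].
    by rewrite subrr mul1r andbT.
  rewrite andbF ifF ?ifF ?mul0r //; lia.
have lt_bl : b + 1 < l by lia.
rewrite G_rec //= ?size_nu // contr; last by lia.
case: d => [|d]; first by rewrite addr0 grade0.
rewrite IHk; [|lia|lia]; rewrite contr; last by lia.
rewrite gradeS // gradeS1.
rewrite [(d%:Z == _)](_ : _ = (d.+1%:Z == l - v + D)); last by apply/idP/idP; lia.
rewrite mulrA -mulrDl !mulrA -!mulrDl; congr (_ * _ * _).
rewrite /step_weight; case: (eqVneq l v) => [<-|neq_lv].
  have [e1 e2 e4] : [/\ (l == l - 1) = false, (l < l - 1) = false & (l - 1 == l) = false].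
    by clear; split; lia.
  have e3 : (l == head b lam) = false by move: lt_hl; clear; lia.
  by rewrite e1 e2 e3 e4 andbF mulr0 !addr0.
(* At v = l - 1 the lowered part contributes 1 and the contraction ['X]; this is the origin of the
   weight 1 + ['X]. *)
case: (eqVneq (l - 1) v) => [E|neq_v].
  by rewrite ifT ?add0r ?mulr1 //; lia.
have -> : (v < l - 1) = (v < l) by lia.
by rewrite add0r mulr0 addr0.
Qed.
End Recursion.

(** * Interlacing statistics as products of row weights *)

Lemma count_iotaS (a : pred nat) n :
  count a (iota 0 n.+1) = (a 0%N + count (fun i => a i.+1) (iota 0 n))%N.
Proof. by rewrite /= (iotaDl 1 0) count_map. Qed.

Lemma interlace_cons l l2 lam m mu :
  interlace (size lam).+2 [:: l, l2 & lam] (m :: mu) =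
  [&& (l2 <= m)%N, (m <= l)%N & interlace (size lam).+1 (l2 :: lam) mu].
Proof. by rewrite /interlace [RHS]andbA -[(size lam).+2.-1]/(size lam).+1 /= (iotaDl 1 0) all_map. Qed.

Lemma r_stat_cons l l2 lam m mu :
  r_stat (size lam).+2 [:: l, l2 & lam] (m :: mu) =
  ((m == l2) + r_stat (size lam).+1 (l2 :: lam) mu)%N.
Proof. exact: count_iotaS. Qed.

Lemma l_stat_cons l l2 lam m mu :
  l_stat (size lam).+2 [:: l, l2 & lam] (m :: mu) =
  ((m == l) + l_stat (size lam).+1 (l2 :: lam) mu)%N.
Proof. exact: count_iotaS. Qed.

Lemma s_stat_cons l l2 lam m mu :
  s_stat (size lam).+2 [:: l, l2 & lam] (m :: mu) =
  ((m < l) + s_stat (size lam).+1 (l2 :: lam) mu)%N.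
Proof. exact: count_iotaS. Qed.

Definition zseq (s : seq nat) : seq int := [seq x%:Z | x <- s].

Lemma isum_rcons x s : isum (rcons s x) = isum s + x.
Proof. by rewrite /isum -cats1 big_cat big_seq1. Qed.

Lemma isum_zseq s : isum (zseq s) = (sumn s)%:Z.
Proof.
elim: s => [|x s IH]; first by rewrite /isum big_nil.
by rewrite isum_cons IH /= PoszD.
Qed.

Lemma decr_above_zseq s : strict_dec_pos s -> decr_above 0 (zseq s).
Proof.
rewrite /strict_dec_pos; elim: s => //= x s IH [ps /andP[x_gt0 s_gt0]].
rewrite decr_aboveE IH; last by split=> //; apply: path_sorted ps.
by rewrite andbT; case: s ps {IH s_gt0} => //= y s /andP[]; rewrite ltz_nat.
Qed.

Lemma decr_above_rcons b b' s : b < b' -> decr_above b' s -> decr_above b (rcons s b').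
Proof.
move=> lt_bb; elim: s => [|x s IH]; first by rewrite /= /decr_above /= lt_bb.
rewrite rcons_cons !decr_aboveE => /andP[Hx /IH ->].
by rewrite andbT; case: s Hx {IH}.
Qed.

(** An index with mu_i = lambda_(i+1) also has mu_i < lambda_i, so the truncated difference s - r is
    a true one. *)
Lemma r_stat_le_s l lam mu : size lam = size mu -> sorted (fun a b : nat => (b < a)%N) (l :: lam) ->
  (r_stat (size lam).+1 (l :: lam) mu <= s_stat (size lam).+1 (l :: lam) mu)%N.
Proof.
elim: lam l mu => [|l2 lam IH] l [|m mu] //= [size_lam] /andP[lt_l Hp].
rewrite r_stat_cons s_stat_cons; have := IH l2 mu size_lam Hp; lia.
Qed.

(** The two bounds fix the sign of the exponent of x: nonnegative in the first matrix element, and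
    negative in the second because k > lambda_1. *)
Lemma interlace_sumn l lam mu : size lam = size mu ->
  interlace (size lam).+1 (l :: lam) mu ->
  (sumn mu <= sumn (l :: lam) <= l + sumn mu)%N.
Proof.
elim: lam l mu => [|l2 lam IH] l [|m mu] //=.
move=> [size_lam]; rewrite interlace_cons => /and3P[le1 le2 /(IH _ _ size_lam) /andP[le3 le4]].
by rewrite /= in le3 le4 *; lia.
Qed.

(** The appended 0 lies strictly between the sea level -1 and the last part of lambda, so the last
    row always weighs 1 + ['X]. This is the extra 1 in the exponent. *)
Lemma weight_rcons0 l lam mu : size lam = size mu -> strict_dec_pos (l :: lam) ->
  weight (- 1) (zseq (l :: lam)) (rcons (zseq mu) 0) =
  if interlace (size lam).+1 (l :: lam) mu
  then 'X ^+ r_stat (size lam).+1 (l :: lam) mu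
       * (1 + 'X) ^+ (s_stat (size lam).+1 (l :: lam) mu - r_stat (size lam).+1 (l :: lam) mu).+1
  else 0.
Proof.
elim: lam l mu => [|l2 lam IH] l [|m mu] //.
  move=> _ [_ /= l_gt0]; rewrite /step_weight ifF; last by lia.
  by rewrite ifT ?mulr1 ?mul1r ?expr1 //; lia.
move=> [size_lam] Hdec.
have Hdec2 : strict_dec_pos (l2 :: lam) by case: Hdec => /= /andP[_ ?] /andP[_ ?].
have lt_l : (l2 < l)%N by case: Hdec => /= /andP[].
have Hrs := r_stat_le_s size_lam (proj1 Hdec2).
rewrite -[LHS]/(step_weight l l2 m * weight (- 1) (zseq (l2 :: lam)) (rcons (zseq mu) 0)) IH //.
rewrite interlace_cons r_stat_cons s_stat_cons.
case: ifP => _; last by rewrite mulr0 !andbF.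
rewrite andbT /step_weight !eqz_nat !ltz_nat.
move: Hrs; set r := r_stat _ _ _; set s := s_stat _ _ _ => Hrs.
case: (ltngtP m l) => [lt_ml|gt_ml|->] /=.
- case: (ltngtP l2 m) => [lt_m|gt_m|_] /=.
  + by rewrite add0n add1n subSn // [in RHS]exprS mulrCA.
  + by rewrite mul0r.
  + by rewrite !add1n subSS [in RHS]exprS mulrA.
- by rewrite [_ == l2]gtn_eqF ?andbF ?mul0r //; lia.
- by rewrite gtn_eqF // ltnW //= mul1r !add0n.
Qed.

Lemma weight_cons k l lam mu : size lam = size mu -> strict_dec_pos (l :: lam) ->
  sorted (fun a b : nat => (b < a)%N) (k :: mu) -> (l <= k)%N ->
  weight 0 (k%:Z :: zseq mu) (zseq (l :: lam)) =
  if interlace (size lam).+1 (l :: lam) mu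
  then 'X ^+ l_stat (size lam).+1 (l :: lam) mu
       * (1 + 'X) ^+ ((l < k) + s_stat (size lam).+1 (l :: lam) mu
                      - r_stat (size lam).+1 (l :: lam) mu)
  else 0.
Proof.
elim: lam k l mu => [|l2 lam IH] k l [|m mu] //.
  move=> _ [_ /= l_gt0] _; rewrite /step_weight /l_stat /r_stat /s_stat /= eqz_nat !ltz_nat.
  rewrite (leq_eqVlt l k) mulr1; case: eqP => [->|_] /=; first by rewrite ltnn !mul1r.
  by move=> ->; move: l_gt0; rewrite !andbT => ->; rewrite mul1r.
move=> [size_lam] Hdec /andP[lt_mk Hmu] le_lk.
have Hdec2 : strict_dec_pos (l2 :: lam) by case: Hdec => /= /andP[_ ?] /andP[_ ?].
have lt_l : (l2 < l)%N by case: Hdec => /= /andP[].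
have Hrs := r_stat_le_s size_lam (proj1 Hdec2).
rewrite interlace_cons r_stat_cons s_stat_cons l_stat_cons.
rewrite -[LHS]/(step_weight k m l * weight 0 (m%:Z :: zseq mu) (zseq (l2 :: lam))).
rewrite /step_weight !eqz_nat !ltz_nat.
case: (leqP m l) => [le_ml|lt_lm]; last first.
  rewrite andbF ifF; last by lia.
  by rewrite !ifF ?mul0r //; lia.
case: (leqP l2 m) => [le_m|lt_m]; last first.
  (* Now m < l2: the row of m meets a larger part and weighs 0. *)
  rewrite [weight _ _ _](_ : _ = 0) ?mulr0 //=.
  have lt_h : head 0 (zseq mu) < l2%:Z.
    by case: (mu) Hmu Hdec2 => [|m2 mu'] /= Hmu [_ /andP[l2_gt0 _]]; rewrite ltz_nat; lia.
  rewrite /step_weight eqz_nat ltz_nat gtn_eqF //= [(l2 < m)%N]ltnNge (ltnW lt_m) andbF.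
  by rewrite [_ == _]gt_eqF ?mul0r.
rewrite IH //=; case: (interlace _ _ _); last by rewrite mulr0.
move: Hrs; set r := r_stat _ _ _; set s := s_stat _ _ _; set t := l_stat _ _ _ => Hrs.
have -> : (m == l2) = ~~ (l2 < m)%N by lia.
case: (ltnP l2 m) => lt_lm; case: (ltngtP l k) le_lk => // [lt_lk|eq_lk] _;
  case: (ltngtP m l) le_ml => // [lt_ml|eq_ml] _ /=;
  rewrite ?(mul1r, add0n, add1n, subn0, subSS, expr0) //.
all: try (by rewrite exprS mulrA); try lia.
- by rewrite (@subSn r s.+1) ?leqW // [in RHS]exprS mulrCA.
- by rewrite subSn // [in RHS]exprS mulrCA.
Qed.

(** * Operators on functionals *)

(* Linear functionals on Fock space: a basis state is the finite set of positions where it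
   differs from the vacuum.  Operators act on functionals by transposition, which reverses
   the order of products. *)
Definition functional := {fset int} -> coefR^o.

HB.instance Definition _ := GRing.Lmodule.copy functional ({fset int} -> (coefR : nzRingType)^o).

(** Bundled so that all linear operators form an [algType], as [exp_op] requires. *)
Record endo := Endo { endo_fun :> functional -> functional; endo_linear : linear endo_fun }.

Lemma endoP (f g : endo) : (forall u S, f u S = g u S) -> f = g.
Proof.
case: f g => f Hf [g Hg] /= E.
have Efg : f = g by apply/funext => u; apply/funext => S.
by rewrite Efg in Hf *; congr Endo; apply: Prop_irrelevance.
Qed.

HB.instance Definition _ := gen_eqMixin endo.
HB.instance Definition _ := gen_choiceMixin endo.

Fact endo0_linear : linear (fun _ : functional => 0 : functional).
Proof. by move=> x u v; rewrite scaler0 addr0. Qed.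
Fact endo1_linear : linear (fun u : functional => u).
Proof. by []. Qed.
Fact endo_opp_linear (f : endo) : linear (fun u => - f u).
Proof. by move=> x u v; rewrite endo_linear opprD scalerN. Qed.
Fact endo_add_linear (f g : endo) : linear (fun u => f u + g u).
Proof. by move=> x u v; rewrite !endo_linear scalerDr addrACA. Qed.
Fact endo_mul_linear (f g : endo) : linear (fun u => f (g u)).
Proof. by move=> x u v; rewrite !endo_linear. Qed.
Fact endo_scale_linear (a : coefR) (f : endo) : linear (fun u => a *: f u).
Proof. by move=> x u v; rewrite endo_linear scalerDr !scalerA mulrC. Qed.

Fact endo_addA : associative (fun f g => Endo (endo_add_linear f g)).
Proof. by move=> f g h; apply: endoP => u S /=; rewrite addrA. Qed.
Fact endo_addC : commutative (fun f g => Endo (endo_add_linear f g)).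
Proof. by move=> f g; apply: endoP => u S /=; rewrite addrC. Qed.
Fact endo_add0 : left_id (Endo endo0_linear) (fun f g => Endo (endo_add_linear f g)).
Proof. by move=> f; apply: endoP => u S /=; rewrite add0r. Qed.
Fact endo_addN : left_inverse (Endo endo0_linear) (fun f => Endo (endo_opp_linear f))
  (fun f g => Endo (endo_add_linear f g)).
Proof. by move=> f; apply: endoP => u S /=; rewrite addNr. Qed.
HB.instance Definition _ :=
  GRing.isZmodule.Build endo endo_addA endo_addC endo_add0 endo_addN.

Lemma endoD (f g : endo) u S : (f + g) u S = f u S + g u S. Proof. by []. Qed.
Lemma endoN (f : endo) u S : (- f) u S = - f u S. Proof. by []. Qed.
Lemma endo_0 u S : (0 : endo) u S = 0. Proof. by []. Qed.
Lemma endo_sum I r (P : pred I) (F : I -> endo) u S :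
  (\sum_(i <- r | P i) F i) u S = \sum_(i <- r | P i) F i u S.
Proof. by elim/big_rec2: _ => // i y1 y2 _ <-. Qed.

Lemma linear_fun0 (f : endo) : f 0 = 0.
Proof. by have := endo_linear f (-1) 0 0; rewrite scaler0 addr0 scaleN1r addNr. Qed.
Lemma linear_funD (f : endo) u v : f (u + v) = f u + f v.
Proof. by have := endo_linear f 1 u v; rewrite !scale1r. Qed.
Lemma linear_funZ (f : endo) x u : f (x *: u) = x *: f u.
Proof. by have := endo_linear f x u 0; rewrite linear_fun0 !addr0. Qed.

Fact endo_mulA : associative (fun f g => Endo (endo_mul_linear f g)).
Proof. by move=> f g h; apply: endoP. Qed.
Fact endo_mul1 : left_id (Endo endo1_linear) (fun f g => Endo (endo_mul_linear f g)).
Proof. by move=> f; apply: endoP. Qed.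
Fact endo_1mul : right_id (Endo endo1_linear) (fun f g => Endo (endo_mul_linear f g)).
Proof. by move=> f; apply: endoP. Qed.
Fact endo_mulDl : left_distributive (fun f g => Endo (endo_mul_linear f g)) +%R.
Proof. by move=> f g h; apply: endoP. Qed.
Fact endo_mulDr : right_distributive (fun f g => Endo (endo_mul_linear f g)) +%R.
Proof. by move=> f g h; apply: endoP => u S /=; rewrite linear_funD. Qed.
Fact endo_1neq0 : Endo endo1_linear != 0.
Proof.
apply/eqP => E; have := congr1 (fun f : endo => f (fun=> 1) fset0) E.
by apply/eqP/oner_neq0.
Qed.
HB.instance Definition _ := GRing.Zmodule_isNzRing.Build endo
  endo_mulA endo_mul1 endo_1mul endo_mulDl endo_mulDr endo_1neq0.

Lemma endoM (f g : endo) u : (f * g) u = f (g u). Proof. by []. Qed.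
Lemma endo_1 u : (1 : endo) u = u. Proof. by []. Qed.

Fact endo_scaleA a b (f : endo) :
  Endo (endo_scale_linear a (Endo (endo_scale_linear b f))) = Endo (endo_scale_linear (a * b) f).
Proof. by apply: endoP => u S /=; rewrite scalerA. Qed.
Fact endo_scale1 : left_id 1 (fun a f => Endo (endo_scale_linear a f)).
Proof. by move=> f; apply: endoP => u S /=; rewrite scale1r. Qed.
Fact endo_scaleDr : right_distributive (fun a f => Endo (endo_scale_linear a f)) +%R.
Proof. by move=> a f g; apply: endoP => u S /=; rewrite scalerDr. Qed.
Fact endo_scaleDl f : {morph (fun a => Endo (endo_scale_linear a f)) : a b / a + b}.
Proof. by move=> a b; apply: endoP => u S /=; rewrite scalerDl. Qed.
HB.instance Definition _ := GRing.Zmodule_isLmodule.Build coefR endo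
  endo_scaleA endo_scale1 endo_scaleDr endo_scaleDl.

Lemma endoZ a (f : endo) u S : (a *: f) u S = a * f u S. Proof. by []. Qed.

Fact endo_scaleAl (a : coefR) (f g : endo) : a *: (f * g) = (a *: f) * g.
Proof. exact: endoP. Qed.
HB.instance Definition _ := GRing.Lmodule_isLalgebra.Build coefR endo endo_scaleAl.
Fact endo_scaleAr (a : coefR) (f g : endo) : a *: (f * g) = f * (a *: g).
Proof. by apply: endoP => u S; rewrite endoZ !endoM /=; rewrite linear_funZ. Qed.
HB.instance Definition _ := GRing.Lalgebra_isAlgebra.Build coefR endo endo_scaleAr.

(** [flip] prepends, so one Maya diagram has lists in several orders; sets identify them. *)
Definition fset_of (D : state) : {fset int} := [fset x in D]%fset.

Lemma in_fset_of x D : (x \in fset_of D) = (x \in D).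
Proof. by rewrite !inE. Qed.

Lemma perm_fset_of D : uniq D -> perm_eq D (fset_of D).
Proof. by move=> uD; apply: uniq_perm (fset_uniq _) _ => // x; rewrite in_fset_of. Qed.

Lemma mem_flip D m x : (x \in flip D m) = (x == m) (+) (x \in D).
Proof.
rewrite /flip; case: ifP => Dm; last by rewrite inE; case: eqP => // ->; rewrite Dm.
by rewrite mem_filter /=; case: eqP => //= ->; rewrite Dm.
Qed.

Lemma uniq_flip D m : uniq D -> uniq (flip D m).
Proof. by rewrite /flip; case: ifP => Dm uD; rewrite ?filter_uniq //= Dm. Qed.

Lemma sign_count_flip D m (a : pred int) : uniq D ->
  (-1 : coefR) ^+ count a (flip D m) = (-1) ^+ count a D * (-1) ^+ a m.
Proof.
rewrite /flip => uD; case: ifP => Dm; last by rewrite /= exprD mulrC.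
rewrite -rem_filter // count_rem Dm /=; case am: (a m); last by rewrite subn0 mulr1.
rewrite -[in RHS](@subnK 1 (count a D)); last by rewrite -has_count; apply/hasP; exists m.
by rewrite addn1 exprSr expr1 -mulrA mulrNN !mulr1.
Qed.

Lemma sgn_perm D D' m : perm_eq D D' -> sgn D m = sgn D' m.
Proof. by rewrite /sgn => /permP ->. Qed.

Lemma occ_fset_of D m : occ (fset_of D) m = occ D m.
Proof. by rewrite /occ in_fset_of. Qed.

Lemma sgn_fset_of D m : uniq D -> sgn (fset_of D) m = sgn D m.
Proof. by move=> uD; rewrite (sgn_perm _ (perm_fset_of uD)). Qed.

Definition toggle (S : {fset int}) (m : int) : {fset int} := fset_of (flip S m).

Lemma in_toggle S m x : (x \in toggle S m) = (x == m) (+) (x \in S).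
Proof. by rewrite in_fset_of mem_flip. Qed.

Lemma toggle_fset_of D m : toggle (fset_of D) m = fset_of (flip D m).
Proof. by apply/fsetP => x; rewrite in_toggle !in_fset_of mem_flip. Qed.

Lemma toggleK S m : toggle (toggle S m) m = S.
Proof. by apply/fsetP => x; rewrite !in_toggle addbA addbb. Qed.

Lemma toggleC S a b : toggle (toggle S a) b = toggle (toggle S b) a.
Proof. by apply/fsetP => x; rewrite !in_toggle addbCA. Qed.

Lemma occ_toggle S a b : occ (toggle S a) b = (b == a) (+) occ S b.
Proof. by rewrite /occ in_toggle addbCA. Qed.

Lemma sgn_toggle S a b : sgn (toggle S a) b = sgn S b * (-1) ^+ (b < a)%R.
Proof.
rewrite /toggle sgn_fset_of ?uniq_flip ?fset_uniq // /sgn !exprD.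
by rewrite sign_count_flip ?fset_uniq // mulrAC.
Qed.

Lemma sgn_sqr S m : sgn S m * sgn S m = 1.
Proof. by rewrite /sgn -expr2 sqrr_sign. Qed.

(* Transpose of psi_m when [e] holds, and of psi^*_m otherwise. *)
Definition fermi_fun (e : bool) (m : int) (u : functional) : functional :=
  fun S => if occ S m == e then sgn S m * u (toggle S m) else 0.

Fact fermi_linear e m : linear (fermi_fun e m).
Proof.
move=> x u v; apply/funext => S; rewrite /fermi_fun.
have -> : forall w w' : functional, (x *: w + w') S = x * w S + w' S :> coefR by [].
by case: ifP => _; [rewrite mulrDr mulrCA | rewrite mulr0 addr0].
Qed.

Definition fermi e m : endo := Endo (fermi_linear e m).

Lemma fermiE e m u S :
  fermi e m u S = if occ S m == e then sgn S m * u (toggle S m) else 0.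
Proof. by []. Qed.

(** Toggling the higher position reverses the sign at the lower one but not conversely, so the two
    orders differ by exactly one sign. *)
Lemma fermi_anticomm e e' a b : (a != b) || (e == e') ->
  fermi e a * fermi e' b = - (fermi e' b * fermi e a).
Proof.
move=> neq; apply: endoP => u S; rewrite endoN !endoM !fermiE !occ_toggle [b == a]eq_sym.
case: (eqVneq a b) neq => /= [<- /eqP ->|neq _].
  by case: (occ S a) e' => -[]; rewrite /= ?mulr0 ?oppr0.
case: (occ S a == e); case: (occ S b == e'); rewrite ?mulr0 ?oppr0 //.
rewrite !sgn_toggle toggleC; case: (ltgtP a b) neq => // _ _ /=; ring.
Qed.

Lemma fermi_sum e a : fermi e a * fermi (~~ e) a + fermi (~~ e) a * fermi e a = 1.
Proof.
apply: endoP => u S; rewrite endoD !endoM !fermiE !occ_toggle eqxx endo_1 toggleK.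
rewrite sgn_toggle ltxx mulr1.
by case: (occ S a) e => -[]; rewrite /= ?mulr0 ?addr0 ?add0r mulrA sgn_sqr mul1r.
Qed.

Lemma fermi_sqr e a : fermi e a * fermi e a = 0.
Proof.
apply: endoP => u S; rewrite endoM !fermiE occ_toggle eqxx.
by case: (occ S a) e => -[]; rewrite ?mulr0.
Qed.

(** * Currents and their commutators with the fermions *)

Definition current_support (m : int) (S : {fset int}) : pred int :=
  fun p => occ S p && ~~ occ S (p - m).

Lemma lo_st_le D x : x \in 0 :: D -> lo_st D <= x.
Proof.
rewrite /lo_st; elim: D => [|y D IH] /=; first by rewrite inE => /eqP ->.
rewrite !inE ge_min => /or3P[x0|/eqP ->|Dx].
- by rewrite IH ?inE ?x0 ?orbT.
- by rewrite lexx.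
- by rewrite IH ?inE ?Dx ?orbT.
Qed.

Lemma hi_st_ge D x : x \in 0 :: D -> x <= hi_st D.
Proof.
rewrite /hi_st; elim: D => [|y D IH] /=; first by rewrite inE => /eqP ->.
rewrite !inE le_max => /or3P[x0|/eqP ->|Dx].
- by rewrite IH ?inE ?x0 ?orbT.
- by rewrite lexx.
- by rewrite IH ?inE ?Dx ?orbT.
Qed.

Lemma window_uniq D m : uniq (window D m).
Proof.
rewrite map_inj_uniq ?iota_uniq // => i j; lia.
Qed.

(** Nothing is occupied above [hi_st] and everything is below [lo_st], which bounds both the
    particle at p and the hole at p - m. *)
Lemma window_support D m p : occ D p -> ~~ occ D (p - m) -> p \in window D m.
Proof.
move=> Hp Hq.
have le_hi : p <= hi_st D.
  case: (lerP p 0) => p0; first by apply: le_trans p0 (hi_st_ge _); rewrite mem_head.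
  by apply: hi_st_ge; move: Hp; rewrite /occ inE leNgt p0 /= => ->; rewrite orbT.
have ge_lo : lo_st D <= p - m.
  case: (lerP (p - m) 0) => q0.
    by apply: lo_st_le; move: Hq; rewrite /occ inE q0 /= negbK => ->; rewrite orbT.
  by apply: le_trans (lo_st_le _) (ltW q0); rewrite mem_head.
apply/mapP; exists (absz (p - (lo_st D - (`|m|%N)%:Z - 1))%R); last by lia.
by rewrite mem_iota; lia.
Qed.

(** Transpose of psi^*_(p-m) psi_p, hence the opposite order of the factors. *)
Definition current_term m p (u : functional) S := fermi true p (fermi false (p - m) u) S.

Definition current_fun (m : int) (u : functional) : functional :=
  fun S => \sum_(p <- window S m) current_term m p u S.

Fact current_linear m : linear (current_fun m).
Proof.
move=> x u v; apply/funext => S; rewrite /current_fun.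
have -> : forall w w' : functional, (x *: w + w') S = x * w S + w' S :> coefR by [].
rewrite mulr_sumr -big_split /=; apply: eq_bigr => p _.
by rewrite /current_term !endo_linear.
Qed.

Definition current m : endo := Endo (current_linear m).

Lemma current_term0 m p u S : m != 0 -> ~~ current_support m S p -> current_term m p u S = 0.
Proof.
move=> m_neq0; rewrite /current_support /current_term !fermiE occ_toggle.
have -> : (p - m == p) = false by lia.
by case: (occ S p) => //=; case: (occ S (p - m)); rewrite //= mulr0.
Qed.

(** A commutator evaluates the current at S and at a toggled S, whose windows differ; a common index
    set is needed. *)
Lemma currentE m u S W : m != 0 -> uniq W -> {subset current_support m S <= W} ->
  current m u S = \sum_(p <- W) current_term m p u S.
Proof.
move=> m_neq0 uW sub.
have restrict r : \sum_(p <- r) current_term m p u S =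
    \sum_(p <- [seq p <- r | current_support m S p]) current_term m p u S.
  rewrite big_filter [RHS]big_mkcond /=; apply: eq_bigr => p _.
  by case: ifP => // /negbT /current_term0 ->.
rewrite [LHS]restrict [RHS]restrict; apply: perm_big.
apply: uniq_perm; rewrite ?filter_uniq ?window_uniq // => p; rewrite !mem_filter.
case Hp: (current_support m S p) => //=; rewrite sub //.
by case/andP: Hp => *; apply: window_support.
Qed.

Lemma fermi_current e j m u S W : m != 0 -> uniq W ->
  {subset current_support m (toggle S j) <= W} ->
  fermi e j (current m u) S =
  \sum_(p <- W) (fermi e j * (fermi true p * fermi false (p - m))) u S.
Proof.
move=> m_neq0 uW sub; rewrite fermiE (currentE _ m_neq0 uW sub).
case: ifP => occj; last by rewrite big1 // => p _; rewrite endoM fermiE occj.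
by rewrite mulr_sumr; apply: eq_bigr => p _; rewrite endoM [RHS]fermiE occj.
Qed.

Lemma fermi_swap a :
  fermi false a * fermi true a = 1 - fermi true a * fermi false a.
Proof. by rewrite -(fermi_sum true a) /= addrAC subrr add0r. Qed.

Section CurrentCommutators.
Variables (m : int) (S : {fset int}) (j : int).
(** Contains both windows and the index at which the commutator is concentrated: j + m for psi, j
    for psi^*. *)
Let W := undup (window S m ++ window (toggle S j) m ++ [:: j; j + m]).

Let subS : {subset current_support m S <= W}.
Proof.
by move=> p /andP[*]; rewrite mem_undup mem_cat window_support.
Qed.

Let subT : {subset current_support m (toggle S j) <= W}.
Proof.
by move=> p /andP[*]; rewrite mem_undup !mem_cat (@window_support (toggle S j)) ?orbT.
Qed.

Lemma current_psi_at u : m != 0 ->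
  current m (fermi true j u) S = fermi true j (current m u) S + fermi true (j + m) u S.
Proof.
move=> m_neq0; rewrite (currentE _ m_neq0 (undup_uniq _) subS).
rewrite (fermi_current _ _ m_neq0 (undup_uniq _) subT).
have jW : j + m \in W by rewrite mem_undup !mem_cat !inE eqxx !orbT.
(* Spread over W, the extra term lets the identity be checked one p at a time. *)
have -> : fermi true (j + m) u S = \sum_(p <- W) ((p == j + m)%:R : endo) (fermi true p u) S.
  rewrite (bigD1_seq (j + m)) ?undup_uniq //= eqxx endo_1 big1 ?addr0 // => p /negbTE ->.
  by rewrite endo_0.
rewrite -big_split /=; apply: eq_bigr => p _.
transitivity ((fermi true p * fermi false (p - m) * fermi true j) u S) => //.
  transitivity ((fermi true j * (fermi true p * fermi false (p - m))
      + (p == j + m)%:R * fermi true p) u S) => //.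
  congr (endo_fun _ u S).
  case: eqP => [->|neq].
    rewrite addrK -mulrA fermi_swap mulrBr mulr1 mul1r !mulrA.
    by rewrite [fermi true (j + m) * _]fermi_anticomm ?orbT // mulNr opprK addrC.
  rewrite mul0r addr0 -mulrA [fermi false _ * _]fermi_anticomm; last by apply/orP; left; lia.
  by rewrite mulrN !mulrA [fermi true p * _]fermi_anticomm ?orbT // mulNr opprK.
Qed.

Lemma current_psi_star_at u : m != 0 ->
  fermi false j (current m u) S = current m (fermi false j u) S + fermi false (j - m) u S.
Proof.
move=> m_neq0; rewrite (currentE _ m_neq0 (undup_uniq _) subS).
rewrite (fermi_current _ _ m_neq0 (undup_uniq _) subT).
have jW : j \in W by rewrite mem_undup !mem_cat !inE eqxx !orbT.
have -> : fermi false (j - m) u S = \sum_(p <- W) ((p == j)%:R : endo) (fermi false (p - m) u) S.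
  rewrite (bigD1_seq j) ?undup_uniq //= eqxx endo_1 big1 ?addr0 // => p /negbTE ->.
  by rewrite endo_0.
rewrite -big_split /=; apply: eq_bigr => p _.
transitivity ((fermi true p * fermi false (p - m) * fermi false j + (p == j)%:R * fermi false (p - m)) u S) => //.
  rewrite -[LHS]/((fermi false j * (fermi true p * fermi false (p - m))) u S); congr (endo_fun _ u S).
  case: eqP => [->|neq].
    rewrite mulrA fermi_swap mulrBl !mul1r -!mulrA.
    by rewrite [fermi false j * _]fermi_anticomm ?orbT // mulrN opprK addrC.
  rewrite mul0r addr0 mulrA [fermi false j * _]fermi_anticomm; last by apply/orP; left; lia.
  by rewrite mulNr -!mulrA [fermi false j * _]fermi_anticomm ?orbT // mulrN opprK.
Qed.
End CurrentCommutators.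

Lemma current_psi m j : m != 0 ->
  current m * fermi true j = fermi true j * current m + fermi true (j + m).
Proof. by move=> m_neq0; apply: endoP => u S; rewrite endoD !endoM current_psi_at. Qed.

Lemma current_psi_star m j : m != 0 ->
  fermi false j * current m = current m * fermi false j + fermi false (j - m).
Proof. by move=> m_neq0; apply: endoP => u S; rewrite endoD !endoM current_psi_star_at. Qed.

Definition exp_current (sg : int) := exp_op acoef (fun q => current (sg * q%:Z)).

Lemma acoef0 : acoef 0 = 0.
Proof. by rewrite /acoef expr0 subrr mul0r. Qed.

Lemma acoef_log q : q%:R * acoef q = 1 - (- 'X) ^+ q.
Proof.
case: q => [|q]; first by rewrite mul0r expr0 subrr.
rewrite /acoef mulrCA -polyC_natr -polyCM divff ?mulr1 //.
by rewrite pnatr_eq0.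
Qed.

Lemma exp_currentN_psi d j :
  exp_current (-1) d.+1 * fermi true j =
  fermi true j * exp_current (-1) d.+1 + 'X *: (fermi true (j - 1) * exp_current (-1) d)
  + exp_current (-1) d * fermi true (j - 1).
Proof.
rewrite -(@exp_op_conj _ _ _ _ (-1) (fermi true)) ?acoef0 //.
- by rewrite scaleN1r subrK.
- by move=> q; rewrite acoef_log opprK expr1n.
- by move=> q i q_gt0; rewrite current_psi ?mulN1r //; lia.
Qed.

(** On functionals the commutator of the current with psi^* has the sign opposite to [exp_op_conj].
    Negating both c and J repairs it and exchanges the roles of a and b. *)
Lemma exp_op_oppr (A : algType coefR) c (J : nat -> A) d :
  exp_op (fun q => - c q) (fun q => - J q) d = exp_op c J d.
Proof.
have E k d' : exp_pow (fun q => - c q) (fun q => - J q) k d' = exp_pow c J k d'.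
  by elim: k d' => //= k IH d'; apply: eq_bigr => q _; rewrite IH scaleNr scalerN opprK.
by apply: eq_bigr => k _; rewrite E.
Qed.

Lemma exp_current_psi_star d j :
  fermi false j * exp_current 1 d.+1 =
  exp_current 1 d.+1 * fermi false j + 'X *: (exp_current 1 d * fermi false (j - 1))
  + fermi false (j - 1) * exp_current 1 d.
Proof.
rewrite /exp_current -!(exp_op_oppr acoef).
rewrite (@exp_op_conj _ _ _ (-1) _ (fermi false)) ?acoef0 ?oppr0 //.
- by rewrite scaleN1r subrK.
- by move=> q; rewrite mulrN acoef_log opprK expr1n opprB.
- move=> q i q_gt0; rewrite mulrN current_psi_star; last by lia.
  by rewrite mul1r mulNr opprD -addrA addNr addr0.
Qed.

(** * Vacuum amplitudes *)

(** Transposition reverses both products: the bra is read from mu_1 on, the ket from lambda_n on. *)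
Definition psi_prod (s : seq int) : endo := \prod_(x <- s) fermi true x.
Definition psi_star_prod (s : seq int) : endo := \prod_(x <- rev s) fermi false x.

Lemma psi_prod_cons x s : psi_prod (x :: s) = fermi true x * psi_prod s.
Proof. exact: big_cons. Qed.

Lemma psi_star_prod_cons x s : psi_star_prod (x :: s) = psi_star_prod s * fermi false x.
Proof. by rewrite /psi_star_prod rev_cons big_rcons. Qed.

Lemma psi_star_swap a :
  fermi true a * fermi false a = 1 - fermi false a * fermi true a.
Proof. by rewrite -(fermi_sum true a) /= addrK. Qed.

Lemma mulr_signCA (A : nzRingType) n (x y : A) : x * ((-1) ^+ n * y) = (-1) ^+ n * (x * y).
Proof. by rewrite mulrA commr_sign -mulrA. Qed.

Lemma psi_star_psi_prod i s : uniq s ->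
  fermi false i * psi_prod s =
  (if i \in s then (-1) ^+ index i s * psi_prod (rem i s) else 0)
  + (-1) ^+ size s * (psi_prod s * fermi false i).
Proof.
elim: s => [|x s IH] /=.
  by move=> _; rewrite /psi_prod big_nil mulr1 !mul1r add0r.
case/andP=> xs uniq_s; rewrite inE eq_sym psi_prod_cons mulrA.
case: (eqVneq x i) xs => [->|neq_xi] xs /=.
  rewrite fermi_swap mulrBl -[fermi true i * fermi false i * _]mulrA IH // (negbTE xs) add0r.
  rewrite [1 * _]mul1r.
  by rewrite exprS mulN1r mulNr mulr_signCA (mulrA (fermi true i)).
rewrite fermi_anticomm; last by apply/orP; left; lia.
rewrite mulNr -[fermi true x * fermi false i * _]mulrA IH // mulrDr opprD; congr (_ + _).
  case: ifP => _; last by rewrite mulr0 oppr0.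
  by rewrite psi_prod_cons exprS mulN1r mulNr mulr_signCA.
by rewrite exprS mulN1r mulNr mulr_signCA (mulrA (fermi true x)).
Qed.

Lemma psi_star_prod_psi i s : uniq s ->
  psi_star_prod s * fermi true i =
  (if i \in s then (-1) ^+ index i s * psi_star_prod (rem i s) else 0)
  + (-1) ^+ size s * (fermi true i * psi_star_prod s).
Proof.
elim: s => [|x s IH] /=.
  by move=> _; rewrite /psi_star_prod big_nil mulr1 !mul1r add0r.
case/andP=> xs uniq_s; rewrite inE eq_sym psi_star_prod_cons -mulrA.
case: (eqVneq x i) xs => [->|neq_xi] xs /=.
  rewrite fermi_swap mulrBr mulr1 (mulrA (psi_star_prod s)) IH // (negbTE xs) add0r.
  by rewrite expr0 [1 * _]mul1r exprS mulN1r mulNr !mulrA.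
rewrite fermi_anticomm ?neq_xi // mulrN (mulrA (psi_star_prod s)) IH // mulrDl opprD.
congr (_ + _); last by rewrite exprS mulN1r mulNr !mulrA.
case: ifP => _; last by rewrite mul0r oppr0.
by rewrite psi_star_prod_cons exprS mulN1r mulNr !mulrA.
Qed.

Lemma endo_sign n (f : endo) u S : ((-1) ^+ n * f) u S = (-1) ^+ n * f u S.
Proof.
elim: n => [|n IH]; last by rewrite (exprS (-1 : endo)) (exprS (-1 : coefR)) !mulN1r !mulNr endoN IH.
by rewrite (expr0 (-1 : endo)) (expr0 (-1 : coefR)) (mul1r f) (mul1r (f u S)).
Qed.

(** The bra of the vacuum; evaluation at [fset0] applies a functional to the vacuum ket. *)
Definition vac : functional := fun S => (S == fset0)%:R.

Lemma fset_of_nil : fset_of [::] = fset0.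
Proof. by apply/fsetP => x; rewrite in_fset_of inE. Qed.

Lemma occ0 m : occ (fset0 : {fset int}) m = (m <= 0).
Proof. by rewrite -fset_of_nil occ_fset_of /occ addbF. Qed.

Lemma fermi_vac e j : (j <= 0) == e -> fermi e j vac = 0.
Proof.
move=> /eqP je; apply/funext => S; rewrite fermiE /vac.
case: ifP => // /eqP occ_e; case: eqP => [T0|]; last by rewrite mulr0.
by have := occ_toggle S j j; rewrite T0 occ0 je occ_e eqxx; case: (e).
Qed.

Lemma fermi_fset0 e j u : (j <= 0) != e -> fermi e j u fset0 = 0.
Proof. by move=> je; rewrite fermiE occ0 (negbTE je). Qed.

Lemma current_fset0 q u : 0 < q -> current q u fset0 = 0.
Proof.
move=> q_gt0; rewrite (@currentE q u fset0 [::]) ?big_nil //; first by lia.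
by move=> p /andP[]; rewrite !occ0; lia.
Qed.

(** If p + q > 0 the inner factor kills [vac]; otherwise p < 0, and the other factor does so after
    an anticommutation. *)
Lemma current_vac q : 0 < q -> current (- q) vac = 0.
Proof.
move=> q_gt0; apply/funext => S; rewrite [LHS]big1 // => p _.
rewrite /current_term; case: (lerP (p - - q) 0) => [le0|gt0]; last first.
  by rewrite fermi_vac ?linear_fun0 //; apply/eqP; lia.
rewrite -endoM fermi_anticomm; last by apply/orP; left; lia.
by rewrite endoN endoM [fermi true p vac]fermi_vac ?linear_fun0 ?oppr0 //; apply/eqP; lia.
Qed.

Lemma exp_op0 (A : algType coefR) c (J : nat -> A) : exp_op c J 0 = 1.
Proof. by rewrite /exp_op big_ord1 invfact0 scale1r. Qed.

(** [L] may turn the vacuum at this end into that of another sea level, as in [amp_plus_nil]. *)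
Lemma exp_current_left (L : endo) d u :
  (forall q w, 0 < q -> L (current q w) fset0 = 0) ->
  L (exp_current 1 d u) fset0 = (d == 0)%:R * L u fset0.
Proof.
move=> L0; case: d => [|d]; first by rewrite /exp_current exp_op0 mul1r.
rewrite mul0r -endoM /exp_current /exp_op mulr_sumr endo_sum big1 // => k _.
rewrite -scalerAr endoZ; apply/eqP; rewrite mulf_eq0; apply/orP; right; apply/eqP.
have powS w m d' : (L * exp_pow acoef (fun q => current (1 * q%:Z)) m.+1 d') w fset0 = 0.
  elim: m w d' => [|m IH] w d'; rewrite [exp_pow _ _ _ _]/= mulr_sumr endo_sum big1 // => q _.
    case: eqP => _; last by rewrite mul0r mulr0 endo_0.
    rewrite mulr1n (mul1r (_ *: _)) -scalerAr endoZ; case: (posnP q) => [->|q_gt0]; first by rewrite acoef0 mul0r.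
    by rewrite endoM L0 ?mulr0 //; lia.
  by rewrite mulrA; apply: IH.
by case: k => [[|k] lt_k]; [rewrite mulr0 endo_0|exact: powS].
Qed.

Lemma exp_current_vac d : exp_current (-1) d vac = (d == 0)%:R *: vac.
Proof.
case: d => [|d]; first by rewrite /exp_current exp_op0 scale1r.
rewrite scale0r; apply/funext => S; rewrite /exp_current /exp_op endo_sum big1 // => k _.
rewrite endoZ; case: k => [[|k] lt_k]; first by rewrite [X in _ * X](_ : _ = 0) ?mulr0.
rewrite [exp_pow _ _ _ _]/=.
rewrite endo_sum big1 ?mulr0 // => q _; rewrite endoM.
case: (posnP q) => [->|q_gt0]; first by rewrite acoef0 scale0r [(0 : endo) vac](_ : _ = 0) // linear_fun0.
rewrite mulN1r [(_ *: current _) vac](_ : _ = acoef q *: current (- q%:Z) vac) //.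
by rewrite current_vac ?scaler0 ?linear_fun0.
Qed.

(* The outer fermions at 0 lower the Dirac sea to the level -1. *)
Definition amp_plus (lam : seq int) (d : nat) (nu : seq int) : coefR :=
  (fermi true 0 * psi_star_prod lam * exp_current 1 d * psi_prod nu * fermi false 0) vac fset0.

Definition amp_minus (nu : seq int) (d : nat) (lam : seq int) : coefR :=
  (psi_star_prod lam * exp_current (-1) d * psi_prod nu) vac fset0.

Lemma vac_fset0 : vac fset0 = 1.
Proof. by rewrite /vac eqxx. Qed.

Lemma psi0_psi_star0_vac : (fermi true 0 * fermi false 0) vac = vac.
Proof.
rewrite psi_star_swap; apply/funext => S.
by rewrite endoD endoN endoM (@fermi_vac true 0) // linear_fun0 oppr0 addr0 endo_1.
Qed.

Lemma decr_above_uniq b s : decr_above b s -> uniq s.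
Proof.
elim: s => //= x s IH Hx; have Hs : decr_above b s by move: Hx; rewrite decr_aboveE => /andP[].
rewrite IH // andbT; apply/negP => xs.
by have := decr_above_lt Hx xs; rewrite ltxx.
Qed.

Lemma psi0_psi_star0_left w : (fermi true 0 * fermi false 0 : endo) w fset0 = w fset0.
Proof.
by rewrite psi_star_swap endoD endoN endoM fermi_fset0 // oppr0 addr0 endo_1.
Qed.

Lemma psi_prod1 x : psi_prod [:: x] = fermi true x.
Proof. by rewrite /psi_prod big_seq1. Qed.

Lemma psi_star_prod1 x : psi_star_prod [:: x] = fermi false x.
Proof. by rewrite /psi_star_prod big_seq1. Qed.

Lemma exp_current0 sg : exp_current sg 0 = 1.
Proof. exact: exp_op0. Qed.

Lemma amp_plus_nil d : amp_plus [::] d [::] = (d == 0)%:R.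
Proof.
rewrite /amp_plus /psi_star_prod /psi_prod !big_nil !mulr1 -mulrA endoM endoM exp_current_left.
  by rewrite -endoM psi0_psi_star0_vac vac_fset0 mulr1.
move=> q w q_gt0; rewrite -endoM.
(* Moving the current past [fermi true 0] leaves [fermi true q] with q > 0, and both terms vanish at
   the vacuum. *)
have /eqP := current_psi 0 (lt0r_neq0 q_gt0); rewrite -subr_eq => /eqP <-.
by rewrite endoD endoN endoM current_fset0 // add0r add0r fermi_fset0 ?oppr0 //; apply/eqP; lia.
Qed.

Lemma amp_plus_base d (v : int) : -1 < v ->
  amp_plus [:: -1 + 1] d [:: v] = ((d == 0) && (v == -1 + 1))%:R.
Proof.
(* The part 0 refills the level emptied by [fermi true 0], so this end becomes the ordinary
   vacuum. *)
move=> v_gt; rewrite addNr /amp_plus psi_star_prod1 psi_prod1 -!mulrA mulrA.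
rewrite endoM psi0_psi_star0_left endoM (_ : exp_current 1 d _ fset0 = (1 : endo) (exp_current 1 d ((fermi true v * fermi false 0) vac)) fset0) //.
rewrite exp_current_left; last by move=> q w q_gt0; rewrite endo_1 current_fset0.
rewrite endo_1; case: (eqVneq v 0) => [->|neq].
  by rewrite psi0_psi_star0_vac vac_fset0 mulr1 andbT.
by rewrite andbF endoM fermi_fset0 ?mulr0 //; apply/eqP; lia.
Qed.

Lemma amp_plus_dup j lam d nu : amp_plus [:: j, j & lam] d nu = 0.
Proof.
rewrite /amp_plus !psi_star_prod_cons -(mulrA _ (fermi false j)) fermi_sqr.
by rewrite !(mulr0, mul0r) endo_0.
Qed.

(** Uncontracted, the factor reaches [fermi false 0] and dies: by [fermi_sqr] if i = 0, on the
    vacuum if i > 0. *)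
Lemma amp_plus_contraction (i : int) lam d nu : 0 <= i -> uniq nu ->
  (fermi true 0 * psi_star_prod lam * exp_current 1 d * (fermi false i * psi_prod nu) * fermi false 0) vac fset0
  = contraction amp_plus i lam d nu.
Proof.
move=> i_ge0 uniq_nu; rewrite psi_star_psi_prod // /contraction mulrDr mulrDl endoD.
rewrite [X in _ + X](_ : _ = 0); last first.
  rewrite mulr_signCA -[_ * _ * fermi false 0]mulrA endo_sign -!mulrA.
  rewrite !endoM -[fermi false i _]endoM.
  rewrite [(fermi false i * fermi false 0) vac](_ : _ = 0) ?linear_fun0 ?mulr0 //.
  case: (eqVneq i 0) => [->|neq]; first by rewrite fermi_sqr.
  rewrite fermi_anticomm ?neq //; apply/funext => S.
  by rewrite endoN endoM (@fermi_vac false i) ?linear_fun0 ?oppr0 //; apply/eqP; lia.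
rewrite addr0; case: ifP => _; last by rewrite mulr0 mul0r endo_0.
by rewrite mulr_signCA -[_ * _ * fermi false 0]mulrA endo_sign.
Qed.

Lemma amp_plus_rec (j : int) lam d nu : -1 + 1 < j -> decr_above (-1) nu ->
  amp_plus (j :: lam) d nu = contraction amp_plus j lam d nu +
    (if d is d'.+1 then amp_plus (j - 1 :: lam) d' nu + 'X * contraction amp_plus (j - 1) lam d' nu
     else 0).
Proof.
rewrite addNr => j_gt0 /decr_above_uniq uniq_nu.
rewrite -amp_plus_contraction ?ltW // {1}/amp_plus psi_star_prod_cons.
case: d => [|d]; first by rewrite exp_current0 !mulr1 addr0 !mulrA.
rewrite -amp_plus_contraction //; last by lia.
rewrite /amp_plus psi_star_prod_cons mulrA -[_ * fermi false j * _]mulrA exp_current_psi_star.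
rewrite mulrDr mulrDr !mulrDl !endoD -!addrA; congr (_ + _).
rewrite [LHS]addrC; congr (_ + _).

by rewrite -scalerAr -!scalerAl endoZ; congr (_ * endo_fun _ _ _); rewrite !mulrA.
Qed.

Lemma amp_plus_weight lam d nu : decr_above (-1) lam -> decr_above (-1) nu ->
  size nu = size lam ->
  amp_plus lam d nu = weight (-1) lam nu * (d%:Z == isum lam - isum nu)%:R.
Proof.
apply: G_weight => [d'|j l d' n|d' v|j l d' n j_gt dec _].
- exact: amp_plus_nil.
- exact: amp_plus_dup.
- exact: amp_plus_base.
- exact: amp_plus_rec.
Qed.

Lemma amp_minus_nil d : amp_minus [::] d [::] = (d == 0)%:R.
Proof.
rewrite /amp_minus /psi_star_prod /psi_prod !big_nil mulr1 mul1r exp_current_vac.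
by case: d => [|d]; rewrite ?scale1r ?scale0r // vac_fset0.
Qed.

Lemma amp_minus_dup j lam d nu : amp_minus [:: j, j & lam] d nu = 0.
Proof.
rewrite /amp_minus !psi_prod_cons (mulrA (fermi true j)) fermi_sqr.
by rewrite mul0r mulr0 endo_0.
Qed.

Lemma amp_minus_base d (v : int) : 0 < v ->
  amp_minus [:: 0 + 1] d [:: v] = ((d == 0) && (v == 0 + 1))%:R.
Proof.
move=> v_gt0; rewrite add0r /amp_minus psi_star_prod1 psi_prod1.
case: d => [|d].
  rewrite exp_current0 mulr1; case: (eqVneq v 1) => [->|neq].
    rewrite fermi_swap endoD endoN endoM (@fermi_vac false 1) // linear_fun0 oppr0 addr0.
    by rewrite endo_1 vac_fset0.
  rewrite fermi_anticomm ?neq // endoN endoM (@fermi_vac false v) ?linear_fun0 ?oppr0 //.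
  by apply/eqP; lia.
(* In positive degree the part 1 is lowered to 0, where psi kills the vacuum. *)
rewrite -mulrA exp_currentN_psi subrr endoM.
rewrite [(_ + _ : endo) vac](_ : _ = 0) ?linear_fun0 //; apply/funext => S.
rewrite !endoD endoZ !endoM !exp_current_vac (@fermi_vac true 0) // !linear_fun0.
by rewrite scale0r linear_fun0 linear_funZ (@fermi_vac true 0) // scaler0 mulr0 !addr0.
Qed.

Lemma amp_minus_contraction (i : int) nu d lam : 0 < i -> uniq lam ->
  (psi_star_prod lam * fermi true i * exp_current (-1) d * psi_prod nu) vac fset0
  = contraction amp_minus i nu d lam.
Proof.
move=> i_gt0 uniq_lam; rewrite psi_star_prod_psi // /contraction !mulrDl endoD.
rewrite [X in _ + X](_ : _ = 0); last first.
  by rewrite -!mulrA endo_sign endoM fermi_fset0 ?mulr0 //; apply/eqP; lia.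
rewrite addr0; case: ifP => _; last by rewrite !mul0r endo_0.
by rewrite -!mulrA endo_sign /amp_minus !mulrA.
Qed.

Lemma amp_minus_rec (j : int) nu d lam : 0 + 1 < j -> decr_above 0 lam ->
  amp_minus (j :: nu) d lam = contraction amp_minus j nu d lam +
    (if d is d'.+1 then amp_minus (j - 1 :: nu) d' lam + 'X * contraction amp_minus (j - 1) nu d' lam
     else 0).
Proof.
rewrite add0r => j_gt1 /decr_above_uniq uniq_lam.
rewrite -amp_minus_contraction //; last by lia.
rewrite {1}/amp_minus psi_prod_cons.
case: d => [|d]; first by rewrite exp_current0 !mulr1 addr0 !mulrA.
rewrite -amp_minus_contraction //; last by lia.
rewrite /amp_minus psi_prod_cons -[_ * exp_current _ _ * (_ * _)]mulrA.
rewrite (mulrA (exp_current (-1) d.+1)) exp_currentN_psi.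
rewrite !mulrDl !mulrDr !endoD -!addrA; congr (_ + _).
rewrite [LHS]addrC; congr (_ + _).
by rewrite -scalerAl -!scalerAr endoZ; congr (_ * endo_fun _ _ _); rewrite !mulrA.
Qed.

Lemma amp_minus_weight nu d lam : decr_above 0 nu -> decr_above 0 lam ->
  size lam = size nu ->
  amp_minus nu d lam = weight 0 nu lam * (d%:Z == isum nu - isum lam)%:R.
Proof.
apply: G_weight => [d'|j l d' n|d' v|j l d' n j_gt dec _].
- exact: amp_minus_nil.
- exact: amp_minus_dup.
- exact: amp_minus_base.
- exact: amp_minus_rec.
Qed.

(** * From lists of states to functionals *)

Definition pairing (u : functional) (v : vec) : coefR := \sum_(e <- v) e.1 * u (fset_of e.2).

Definition uniq_states (v : vec) : bool := all (fun e => uniq e.2) v.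

(** Signs of lists and of sets agree only without duplicates, so this invariant is carried along
    with the pairing. *)
Definition represents (F : state -> vec) (f : endo) : Prop :=
  forall D, uniq D -> uniq_states (F D) /\ forall u, pairing u (F D) = f u (fset_of D).

Lemma pairing1 u c D : pairing u [:: (c, D)] = c * u (fset_of D).
Proof. by rewrite /pairing big_seq1. Qed.

Lemma pairing_scalev u c v : pairing u (scalev c v) = c * pairing u v.
Proof.
rewrite /pairing /scalev big_map mulr_sumr; apply: eq_bigr => e _ /=; exact: esym (mulrA _ _ _).
Qed.

Lemma pairing_flatten u vs : pairing u (flatten vs) = \sum_(v <- vs) pairing u v.
Proof. exact: big_flatten. Qed.

Lemma pairing_endo_sum I r (F : I -> endo) u v :
  pairing ((\sum_(i <- r) F i) u) v = \sum_(i <- r) pairing (F i u) v.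
Proof.
rewrite /pairing exchange_big; apply: eq_bigr => e _ /=.
by rewrite endo_sum mulr_sumr.
Qed.

Lemma pairing_endoZ c (f : endo) u v : pairing ((c *: f) u) v = c * pairing (f u) v.
Proof. by rewrite /pairing mulr_sumr; apply: eq_bigr => e _; rewrite endoZ mulrCA. Qed.

Lemma pairing_actv F f u v : represents F f -> uniq_states v ->
  pairing u (actv F v) = pairing (f u) v.
Proof.
move=> HF; rewrite /actv pairing_flatten big_map {2}/pairing.
elim: v => [|[c D] v IH] /=; first by rewrite !big_nil.
case/andP=> uD uv; rewrite !big_cons IH //; congr (_ + _).
by rewrite -(proj2 (HF D uD)) -pairing_scalev.
Qed.

Lemma uniq_states_flatten vs : all uniq_states vs -> uniq_states (flatten vs).
Proof. by elim: vs => //= v vs IH /andP[Hv /IH]; rewrite /uniq_states all_cat => ->; rewrite andbT. Qed.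

Lemma uniq_states_scalev c v : uniq_states (scalev c v) = uniq_states v.
Proof. by rewrite /uniq_states /scalev all_map. Qed.

Lemma uniq_states_actv F f v : represents F f -> uniq_states v -> uniq_states (actv F v).
Proof.
move=> HF uv; apply: uniq_states_flatten; rewrite all_map.
apply: sub_all uv => -[c D] /= uD.
by have := (HF D uD).1; rewrite -(uniq_states_scalev c).
Qed.

Lemma represents_psi m : represents (psi m) (fermi true m).
Proof.
move=> D uD; split; first by rewrite /psi; case: ifP => //= _; rewrite uniq_flip.
move=> u; rewrite fermiE occ_fset_of eqb_id toggle_fset_of sgn_fset_of // /psi.
by case: ifP => _; rewrite ?pairing1 // /pairing big_nil.
Qed.

Lemma represents_psi_star m : represents (psi_star m) (fermi false m).
Proof.
move=> D uD; split; first by rewrite /psi_star; case: ifP => //= _; rewrite uniq_flip.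
move=> u; rewrite fermiE occ_fset_of eqbF_neg toggle_fset_of sgn_fset_of // /psi_star.
by case: ifP => _; rewrite ?pairing1 // /pairing big_nil.
Qed.

Lemma represents_current m : m != 0 -> represents (Jb m) (current m).
Proof.
move=> m_neq0 D uD.
have uJ p : uniq_states (psi p D) by case: (represents_psi p uD).
split.
  apply: uniq_states_flatten; rewrite all_map; apply/allP => p _ /=.
  exact: uniq_states_actv (represents_psi_star _) (uJ p).
move=> u; rewrite /Jb pairing_flatten big_map (@currentE _ _ _ (window D m)) ?window_uniq //.
  by apply: eq_bigr => p _; rewrite (pairing_actv _ (represents_psi_star _)) // (represents_psi p uD).2.
by move=> p /andP[]; rewrite !occ_fset_of; apply: window_support.
Qed.

Section ExpPhi.
Variables (sg : int).
Hypothesis sg_neq0 : sg != 0.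

Let Jword (v : vec) (c : seq nat) := foldr (fun q w => J (sg * q%:Z) w) v c.

Lemma comps_gt0 k d c : c \in comps k d -> all (fun q => (0 < q)%N) c.
Proof.
elim: k d c => [|k IH] d c /=; first by case: ifP => // _; rewrite inE => /eqP ->.
case/flatten_mapP=> q; rewrite mem_iota => /andP[q_gt0 _] /mapP[c' Hc' ->] /=.
by rewrite q_gt0 (IH _ _ Hc').
Qed.

Lemma represents_J q : (0 < q)%N -> represents (Jb (sg * q%:Z)) (current (sg * q%:Z)).
Proof. by move=> q_gt0; apply: represents_current; rewrite mulf_neq0 // -lt0n. Qed.

Lemma uniq_states_Jword v c : uniq_states v -> all (fun q => (0 < q)%N) c ->
  uniq_states (Jword v c).
Proof.
move=> uv; elim: c => //= q c IH /andP[q_gt0 /IH].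
exact: uniq_states_actv (represents_J q_gt0).
Qed.

Lemma pairing_comps k d u v : uniq_states v ->
  \sum_(c <- comps k d) (\prod_(q <- c) acoef q) * pairing u (Jword v c) =
  pairing (exp_pow acoef (fun q => current (sg * q%:Z)) k d u) v.
Proof.
move=> uv; elim: k d u => [|k IH] d u.
  rewrite [comps _ _]/= [exp_pow _ _ _ _]/=; case: eqP => _.
    by rewrite big_seq1 big_nil mul1r.
  by rewrite big_nil; apply/esym/big1 => e _; rewrite [X in _ * X](_ : _ = 0) ?mulr0.
rewrite [exp_pow _ _ _ _]/= [comps _ _]/= big_flatten big_map.
(* [exp_pow] also sums over q = 0, which [comps] omits; its coefficient is 0. *)
rewrite big_ord_recl acoef0 scale0r mulr0 add0r pairing_endo_sum.
rewrite (iotaDl 1 0) big_map -[X in iota 0 X]subn0 -/(index_iota 0 d) big_mkord.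
apply: eq_bigr => q _; rewrite big_map lift0 [(1 + _)%N]add1n.
rewrite -scalerAr pairing_endoZ endoM -IH mulr_sumr.
rewrite big_seq [RHS]big_seq; apply: eq_bigr => c /comps_gt0 c_gt0.
rewrite big_cons /= -mulrA; congr (_ * (_ * _)).
by rewrite (pairing_actv _ (represents_J _)) // uniq_states_Jword.
Qed.

Lemma pairing_expPhi d u v : uniq_states v ->
  pairing u (expPhi sg d v) = pairing (exp_current sg d u) v.
Proof.
move=> uv; rewrite /expPhi pairing_flatten big_map /exp_current /exp_op pairing_endo_sum.
rewrite -[X in iota 0 X]subn0 -/(index_iota 0 d.+1) big_mkord.
apply: eq_bigr => k _; rewrite pairing_flatten big_map pairing_endoZ -pairing_comps // mulr_sumr.
by apply: eq_bigr => c _; rewrite pairing_scalev mulrA.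
Qed.

Lemma uniq_states_expPhi d v : uniq_states v -> uniq_states (expPhi sg d v).
Proof.
move=> uv; apply: uniq_states_flatten; rewrite all_map; apply/allP => k _ /=.
apply: uniq_states_flatten; rewrite all_map; apply/allP => c /comps_gt0 c_gt0 /=.
by rewrite uniq_states_scalev uniq_states_Jword.
Qed.
End ExpPhi.

Lemma vac_coefE v : vac_coef v = pairing vac v.
Proof.
rewrite /vac_coef /pairing big_mkcond; apply: eq_bigr => e _.
have -> : nilp e.2 = (fset_of e.2 == fset0).
  case: e => c [|x D] /=; first by rewrite fset_of_nil eqxx.
  by apply/esym/negP => /eqP/fsetP/(_ x); rewrite in_fset_of mem_head in_fset0.
by rewrite /vac; case: eqP => _; rewrite ?mulr1 ?mulr0.
Qed.

Lemma bra_pairE mu w : uniq_states w -> bra_pair mu w = pairing (psi_prod (zseq mu) vac) w.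
Proof.
rewrite /bra_pair vac_coefE; elim: mu w => [|m mu IH] w uw /=.
  by rewrite /psi_prod big_nil.
rewrite IH; last exact: uniq_states_actv (represents_psi _) uw.
by rewrite (pairing_actv _ (represents_psi _)) // psi_prod_cons.
Qed.

Lemma uniq_states_ket lam : uniq_states (ket lam).
Proof. by elim: lam => //= l lam IH; exact: uniq_states_actv (represents_psi_star _) IH. Qed.

Lemma pairing_ket u lam : pairing u (ket lam) = psi_star_prod (zseq lam) u fset0.
Proof.
elim: lam u => [|l lam IH] u /=.
  by rewrite /psi_star_prod big_nil pairing1 mul1r fset_of_nil.
by rewrite (pairing_actv _ (represents_psi_star _)) ?uniq_states_ket // IH psi_star_prod_cons.
Qed.

Lemma psi0_vac_rcons mu : psi_prod (zseq mu) vac = psi_prod (rcons (zseq mu) 0) (fermi false 0 vac).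
Proof. by rewrite /psi_prod -cats1 big_cat big_seq1 -[in LHS]psi0_psi_star0_vac. Qed.

(** No part equals 0, so nothing is contracted; the sign is the (-1)^n of the first formula. *)
Lemma psi_star_prod_psi0 lam : decr_above 0 lam ->
  psi_star_prod lam * fermi true 0 = (-1) ^+ size lam * (fermi true 0 * psi_star_prod lam).
Proof.
move=> dec; rewrite psi_star_prod_psi ?(decr_above_uniq dec) // ifF ?add0r //.
by apply/negP => /(decr_above_gt dec); rewrite ltxx.
Qed.

Lemma ME_plusE mu lam (d : nat) : strict_dec_pos lam ->
  ME_plus mu lam d%:Z = (-1) ^+ size lam * amp_plus (zseq lam) d (rcons (zseq mu) 0).
Proof.
move=> dec; have ups := represents_psi 0; have uk := uniq_states_ket lam.
have uw := uniq_states_actv ups uk.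
rewrite /ME_plus /= bra_pairE ?uniq_states_expPhi // pairing_expPhi //.
rewrite (pairing_actv _ ups) // pairing_ket psi0_vac_rcons.
rewrite -endoM psi_star_prod_psi0 ?decr_above_zseq // endo_sign size_map /amp_plus.
by congr (_ * _); rewrite !endoM.
Qed.

Lemma ME_minusE mu lam (k : nat) (d : nat) :
  ME_minus mu lam k%:Z (- d%:Z) = amp_minus (k%:Z :: zseq mu) d (zseq lam).
Proof.
have uk := uniq_states_ket lam; have uw := @uniq_states_expPhi (-1) isT d _ uk.
rewrite /ME_minus oppr_le0 /= abszN bra_pairE; last exact: uniq_states_actv (represents_psi _) uw.
rewrite (pairing_actv _ (represents_psi _)) // pairing_expPhi // pairing_ket.
by rewrite /amp_minus psi_prod_cons !endoM.
Qed.

Lemma decr_above_weaken b b' s : b' <= b -> decr_above b s -> decr_above b' s.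
Proof.
move=> le_b; elim: s => [|x s IH] //; rewrite !decr_aboveE => /andP[Hx /IH ->].
by case: s Hx {IH} => [|y s] /= Hx; rewrite andbT // (le_lt_trans le_b).
Qed.

Lemma amp_minus_swap j m s d lam : amp_minus [:: j, m & s] d lam = - amp_minus [:: m, j & s] d lam.
Proof.
rewrite /amp_minus !psi_prod_cons !(mulrA (fermi true _)) [fermi true j * _]fermi_anticomm ?orbT //.
by rewrite mulNr mulrN endoN.
Qed.

(* Covers a part of mu that is at least k, where (k, mu) is not decreasing. *)
Lemma amp_minus_large (j m : int) s d lam : decr_above 0 lam -> 0 < j ->
  {in lam, forall x, x < j} -> j <= m -> amp_minus [:: m, j & s] d lam = 0.
Proof.
move=> dec j_gt0 lt_j le_jm.
have [i ->] : exists i : nat, m = j + i%:Z by exists (absz (m - j)); lia.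
have contr0 x nu' d' : j <= x -> contraction amp_minus x nu' d' lam = 0.
  by move=> le_jx; rewrite /contraction ifF //; apply/negP => /lt_j; lia.
elim: i d => [|i IH] d; first by rewrite addr0 amp_minus_dup.
rewrite amp_minus_rec //; last by lia.
rewrite contr0 ?add0r; last by lia.
case: d => [|d] //; rewrite contr0 ?mulr0 ?addr0; last by lia.
have -> : j + i.+1%:Z - 1 = j + i%:Z by lia.
exact: IH.
Qed.

Theorem mainTheorem1 (n : nat) (lam mu : seq nat) (k : int) :
  (1 <= n)%N -> size lam = n -> size mu = n.-1 ->
  strict_dec_pos lam -> strict_dec_pos mu ->
  (nth 0%N lam 0)%:Z < k ->
  (forall e : int,
     ME_plus mu lam e =
       if interlace n lam mu && (e == (sumn lam)%:Z - (sumn mu)%:Z)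
       then (-1) ^+ n * 'X ^+ r_stat n lam mu
            * (1 + 'X) ^+ (s_stat n lam mu - r_stat n lam mu).+1
       else 0) /\
  (forall e : int,
     ME_minus mu lam k e =
       if interlace n lam mu && (e == (sumn lam)%:Z - (sumn mu)%:Z - k)
       then 'X ^+ l_stat n lam mu
            * (1 + 'X) ^+ (s_stat n lam mu - r_stat n lam mu).+1
       else 0).
Proof.
case: lam => [|l lam] n_gt0 size_n; first by rewrite -size_n in n_gt0.
rewrite -size_n /= => size_mu dec_lam dec_mu {n n_gt0 size_n}.
case: k => // k; rewrite ltz_nat => lt_lk.
have size_lam : size lam = size mu by [].
have dz_lam := decr_above_zseq dec_lam; have dz_mu := decr_above_zseq dec_mu.
have Hsum := @interlace_sumn l _ _ size_lam.
have Hrs := r_stat_le_s size_lam (proj1 dec_lam).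
split=> e.
  case: (lerP 0 e) => [e_ge0|e_lt0]; last first.
    rewrite /ME_plus leNgt e_lt0 /= ifF //; apply/negP => /andP[/Hsum /= Hs /eqP E]; lia.
  rewrite -(gez0_abs e_ge0); set d := absz e.
  rewrite ME_plusE // amp_plus_weight; last 3 first.
  - exact: decr_above_weaken dz_lam.
  - exact: decr_above_rcons dz_mu.
  - by rewrite size_rcons !size_map /= size_lam.
  rewrite weight_rcons0 // isum_rcons addr0 !isum_zseq.
  case: ifP => _; last by rewrite mul0r mulr0.
  by case: eqP => _; rewrite ?mulr0 ?mulr1 // mulrA.
case: (lerP e 0) => [e_le0|e_gt0]; last first.
  rewrite /ME_minus leNgt e_gt0 /= ifF //; apply/negP => /andP[/Hsum /= Hs /eqP E]; lia.
have -> : e = - (absz e)%:Z by lia.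
set d := absz e; rewrite ME_minusE.
(* If mu_1 >= k, interlacing fails because k > lambda_1; the amplitude vanishes after k and mu_1 are
   exchanged. *)
case Hk: (sorted (fun a b : nat => (b < a)%N) (k :: mu)); last first.
  case: mu size_mu size_lam dec_mu dz_mu Hsum Hrs Hk => [|m mu] //= size_mu _ [/= mu_path _] _ _ _.
  rewrite mu_path andbT => /negbT; rewrite -leqNgt => le_km.
  case: lam size_mu dec_lam lt_lk dz_lam => [|l2 lam] // _ dec_lam lt_lk dz_lam.
  rewrite interlace_cons ifF; last by apply/negP => /andP[/and3P[_ le_ml _] _]; lia.
  rewrite amp_minus_swap amp_minus_large ?oppr0 //; first by rewrite ltz_nat; lia.
  move=> x; rewrite inE => /orP[/eqP ->|]; first by rewrite ltz_nat.
  by move/(decr_above_lt dz_lam) => lt_xl; apply: lt_trans lt_xl _; rewrite ltz_nat.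
rewrite amp_minus_weight //; last 2 first.
- apply: (@decr_above_zseq (k :: mu)); split=> //=; apply/andP; split; first by lia.
  exact: dec_mu.2.
- by rewrite /= !size_map size_lam.
rewrite weight_cons //; last exact: ltnW.
rewrite lt_lk add1n subSn // isum_cons !isum_zseq.
case: ifP => _; last by rewrite mul0r.
rewrite [(d%:Z == _)](_ : _ = (- d%:Z == (sumn (l :: lam))%:Z - (sumn mu)%:Z - k%:Z)); last by apply/eqP/eqP; lia.
by case: eqP => _; rewrite ?mulr0 ?mulr1.
Qed.
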